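(* Let $(M,\Pi)$ be a regular Poisson manifold with characteristic foliation $\mathcal F$, and choose a complement $TM=T\mathcal F\oplus G$. Assume moreover that $d\gamma=0$. If $\xi\in\mathfrak X^2_{\mathcal F}(M)$ is an infinitesimal deformation of $\Pi$, then $[\xi,\xi]_\gamma$ is exact in $(\mathfrak X^\bullet_{\mathcal F}(M),d_\Pi)$ if and only if $[\xi,\xi]_{SN}$ is exact in $(\mathfrak X^\bullet(M),d_\Pi)$.
   Context: $\Pi$ is a Poisson bivector field whose sharp map $\Pi^\sharp(\eta)=\iota_\eta\Pi$ has constant rank; $T\mathcal F=\operatorname{im}\Pi^\sharp$, with annihilator $T^\circ\mathcal F=\ker\Pi^\sharp$. The leafwise symplectic form $\omega\in\Gamma(\wedge^2T^*\mathcal F)$ satisfies $\Pi=-\omega^{-1}$, i.e. $\Pi^\sharp$ induces $-(\omega^\flat)^{-1}:T^*\mathcal F\to T\mathcal F$ with $\omega^\flat(X)=\iota_X\omega$. $\gamma\in\Omega^2(M)$ is the extension of $\omega$ by zero on $G$: $\gamma|_{T\mathcal F\times T\mathcal F}=\omega$, $\iota_Y\gamma=0$ for $Y\in\Gamma(G)$. $\operatorname{pr}_G$ is the projection of $TM$ onto $G$ along $T\mathcal F$. $[-,-]_{SN}$ is the Schouten–Nijenhuis bracket and $d_\Pi=[\Pi,-]_{SN}$. Good multivector fields: $\mathfrak X^\bullet_{\mathcal F}(M)=\{W\in\mathfrak X^\bullet(M):\iota_\alpha\iota_\beta W=0\ \forall\alpha,\beta\in\Gamma(T^\circ\mathcal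 F)\}$, a subcomplex of $(\mathfrak X^\bullet(M),d_\Pi)$. An infinitesimal deformation of the regular Poisson structure $\Pi$ is a $2$-cocycle in $(\mathfrak X^\bullet_{\mathcal F}(M),d_\Pi)$. $[-,-]_\gamma$ is the degree $0$ graded skew-symmetric bracket on $\mathfrak X^\bullet(M)[1]$ determined by $[X,f]_\gamma=(\operatorname{pr}_GX)(f)$, $[X,Y]_\gamma=[\operatorname{pr}_GX,\operatorname{pr}_GY]-\Pi^\sharp(\mathcal L_{\operatorname{pr}_GX}\iota_Y\gamma-\mathcal L_{\operatorname{pr}_GY}\iota_X\gamma)$ for functions $f$ and vector fields $X,Y$, and $[P,Q\wedge R]_\gamma=[P,Q]_\gamma\wedge R+(-1)^{|Q|(|P|-1)}Q\wedge[P,R]_\gamma$. *)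

(* Defs.v *)
From HB Require Import structures.
From mathcomp Require Import all_boot all_order all_algebra.
From mathcomp Require Import all_classical all_reals all_analysis.

Set Implicit Arguments.
Unset Strict Implicit.
Unset Printing Implicit Defensive.

Import Order.TTheory GRing.Theory Num.Theory.
Import numFieldNormedType.Exports.

Local Open Scope classical_set_scope.
Local Open Scope ring_scope.

(** * Smooth functions on open subsets of R^n *)

Section SmoothOn.
Context {R : realType} {n : nat}.
Implicit Types (V : set 'rV[R]_n) (g h : 'rV[R]_n -> R).

(* For V open: g has continuous iterated partial derivatives of all orders up
   to k on V. The values of g outside V are irrelevant (see [Ck_on_eq]). *)
Fixpoint Ck_on (k : nat) V g : Prop :=
  (forall x, V x -> {for x, continuous g}) /\
  match k with
  | 0 => True
  | k'.+1 => forall i : 'I_n,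
      (forall x, V x -> derivable g x (delta_mx 0 i)) /\
      Ck_on k' V (fun x => 'D_(delta_mx 0 i) g x)
  end.

Definition smooth_on V g := forall k, Ck_on k V g.

Lemma Ck_on_eq k V g h : open V -> (forall x, V x -> g x = h x) ->
  Ck_on k V g -> Ck_on k V h.
Proof.
move=> oV; elim: k g h => [|k IH] g h gh [gc gd].
all: have ngh x : V x -> \forall y \near x, g y = h y
  by move=> Vx; apply: filterS gh _; exact: open_nbhs_nbhs.
all: have hc x : V x -> {for x, continuous h}
  by move=> Vx; rewrite /prop_for /continuous_at -gh//;
     exact: cvg_trans (near_eq_cvg (ngh x Vx)) (gc x Vx).
- by split.
- split=> // i; have [gi gI] := gd i; split.
    move=> x Vx; apply: near_eq_derivable (gi x Vx); exact: ngh.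
  by apply: IH gI => x Vx; apply: near_eq_derive; exact: ngh.
Qed.

Lemma Ck_onW k V g : Ck_on k.+1 V g -> Ck_on k V g.
Proof.
elim: k g => [|k IH] g [gc gd]; first by split.
by split=> // i; have [gi gI] := gd i; split=> //; exact: IH.
Qed.

Lemma Ck_on_cst k V (c : R) : open V -> Ck_on k V (cst c).
Proof.
move=> oV; elim: k c => [|k IH] c; split=> //; try by move=> x _; exact: cst_continuous.
move=> i; split=> [x _|]; first exact: derivable_cst.
by apply: Ck_on_eq (IH 0) => // x _; rewrite derive_cst.
Qed.

Lemma Ck_onD k V g h : open V ->
  Ck_on k V g -> Ck_on k V h -> Ck_on k V (g + h).
Proof.
move=> oV; elim: k g h => [|k IH] g h [gc gd] [hc hd];
  split=> //; try by move=> x Vx; apply: continuousD; [exact: gc|exact: hc].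
move=> i; have [gi gI] := gd i; have [hi hI] := hd i.
split=> [x Vx|]; first by apply: derivableD; [exact: gi|exact: hi].
apply: Ck_on_eq (IH _ _ gI hI) => // x Vx.
by rewrite deriveD//; [exact: gi|exact: hi].
Qed.

Lemma Ck_onM k V g h : open V ->
  Ck_on k V g -> Ck_on k V h -> Ck_on k V (g * h).
Proof.
move=> oV; elim: k g h => [|k IH] g h Ag Ah;
  move: (Ag) (Ah) => [gc gd] [hc hd];
  split=> //; try by move=> x Vx; apply: continuousM; [exact: gc|exact: hc].
move=> i; have [gi gI] := gd i; have [hi hI] := hd i.
split=> [x Vx|]; first by apply: derivableM; [exact: gi|exact: hi].
apply: Ck_on_eq (Ck_onD oV (IH _ _ (Ck_onW Ag) hI) (IH _ _ (Ck_onW Ah) gI)) => //.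
by move=> x Vx; rewrite deriveM//; [exact: gi|exact: hi].
Qed.

Lemma smooth_on_cst V (c : R) : open V -> smooth_on V (cst c).
Proof. by move=> oV k; exact: Ck_on_cst. Qed.

Lemma smooth_onD V g h : open V ->
  smooth_on V g -> smooth_on V h -> smooth_on V (g + h).
Proof. by move=> oV sg sh k; exact: Ck_onD. Qed.

Lemma smooth_onM V g h : open V ->
  smooth_on V g -> smooth_on V h -> smooth_on V (g * h).
Proof. by move=> oV sg sh k; exact: Ck_onM. Qed.

End SmoothOn.

(** * Smooth manifolds *)

Record chart (R : realType) (n : nat) (M : topologicalType) := Chart {
  chart_dom : set M;
  chart_map :> M -> 'rV[R]_n;
  chart_inv : 'rV[R]_n -> M;
  chart_dom_open : open chart_dom;
  chart_cod_open : open (chart_map @` chart_dom);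
  chart_mapK : forall x, chart_dom x -> chart_inv (chart_map x) = x;
  chart_map_continuous :
    forall x, chart_dom x -> {for x, continuous chart_map};
  chart_inv_continuous :
    forall y, (chart_map @` chart_dom) y -> {for y, continuous chart_inv} }.

Arguments chart_dom_open {R n M} c.
Arguments chart_cod_open {R n M} c.

Record manifold (R : realType) (n : nat) := Manifold {
  manifold_carrier :> topologicalType;
  manifold_hausdorff : hausdorff_space manifold_carrier;
  manifold_countable : @second_countable manifold_carrier;
  atlas : set (chart R n manifold_carrier);
  atlas_cover : forall x, exists2 c, atlas c & chart_dom c x;
  atlas_compat : forall c d, atlas c -> atlas d -> forall i : 'I_n,
    smooth_on (c @` (chart_dom c `&` chart_dom d))
              (fun y => d (chart_inv c y) 0 i) }.

Section SmoothFunctions.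
Context {R : realType} {n : nat} (M : manifold R n).

Definition smooth (f : M -> R) := forall c, atlas c ->
  smooth_on (c @` chart_dom c) (f \o chart_inv c).

Definition smooth_pred : {pred M -> R} := mem [set f | smooth f].

Lemma smooth_predP f : f \in smooth_pred <-> smooth f.
Proof. by rewrite inE. Qed.

Lemma smooth_subring : subring_closed smooth_pred.
Proof.
split=> [|f g|f g].
- by apply/smooth_predP => c _; apply: smooth_on_cst; exact: chart_cod_open.
- move=> /smooth_predP sf /smooth_predP sg; apply/smooth_predP => c Ac.
  have oV := chart_cod_open c.
  have -> : (f - g) \o chart_inv c =
      f \o chart_inv c + cst (-1) * (g \o chart_inv c).
    by apply/funext => y /=; rewrite /GRing.add /GRing.mul/= mulN1r.
  apply: smooth_onD => //; first exact: sf.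
  by apply: smooth_onM => //; [exact: smooth_on_cst|exact: sg].
- move=> /smooth_predP sf /smooth_predP sg; apply/smooth_predP => c Ac.
  by apply: smooth_onM; [exact: chart_cod_open|exact: sf|exact: sg].
Qed.

HB.instance Definition _ :=
  GRing.isSubringClosed.Build (M -> R) smooth_pred smooth_subring.

Lemma smooth_scale : GRing.scaler_closed smooth_pred.
Proof.
move=> a f /smooth_predP sf; apply/smooth_predP => c Ac.
have oV := chart_cod_open c.
have -> : (a *: f) \o chart_inv c = cst a * (f \o chart_inv c) by [].
by apply: smooth_onM => //; [exact: smooth_on_cst|exact: sf].
Qed.

HB.instance Definition _ :=
  GRing.isScaleClosed.Build R (M -> R) smooth_pred smooth_scale.

(* The algebra of smooth functions; it is the zero ring when M is empty. *)
Record smoothFun := SmoothFun {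
  smoothFun_val :> M -> R;
  _ : smoothFun_val \in smooth_pred }.

HB.instance Definition _ := [isSub for smoothFun_val].
HB.instance Definition _ := [Choice of smoothFun by <:].
HB.instance Definition _ :=
  GRing.SubChoice_isSubComPzRing.Build _ _ smoothFun smooth_subring.
HB.instance Definition _ := [SubZmodule_isSubLmodule of smoothFun by <:].

End SmoothFunctions.

(** * Tensor calculus on M

   - a vector field is a derivation C -> C of the algebra C of smooth functions,
     a tangent vector at x is a point derivation C -> R at x;
   - a multivector field P of degree k is a skew-symmetric k-derivation,
     P [:: f1; ...; fk] being P(df1, ..., dfk); to avoid casts between degrees
     it is a function of lists that vanishes on lists of length <> k;
   - differential forms are C-multilinear skew-symmetric maps on vector fields;
     their values on maps C -> C that are not vector fields are irrelevant. *)

Section Calculus.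
Context {R : realType} {n : nat} {M : manifold R n}.
Notation C := (smoothFun M).
Notation mv := (seq C -> C).
Implicit Types (f g : C) (X Y Z : C -> C) (P Q W : mv)
  (eta alpha beta : (C -> C) -> C)
  (tau omega gamma : (C -> C) -> (C -> C) -> C) (pr : (C -> C) -> C -> C).

Definition vector_field X :=
  [/\ forall f g, X (f + g) = X f + X g,
      forall (a : R) f, X (a *: f) = a *: X f &
      forall f g, X (f * g) = f * X g + X f * g].

Definition fscale f X : C -> C := fun g => f * X g.

Definition lie X Y : C -> C := fun f => X (Y f) - Y (X f).

(** Differential forms *)

(* C-linear forms on a C-module A of vector fields; the 1-forms on M are the
   case [A = vector_field] *)
Definition form1_on (A : set (C -> C)) eta :=
  forall f X Y, A X -> A Y -> eta (fscale f X \+ Y) = f * eta X + eta Y.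

Definition form2_on (A : set (C -> C)) tau :=
  (forall X, A X -> form1_on A (tau X)) /\
  (forall X Y, A X -> A Y -> tau X Y = - tau Y X).

Definition form1 := form1_on vector_field.
Definition form2 := form2_on vector_field.

(* exterior derivative of a 2-form *)
Definition dform2 tau X Y Z :=
  X (tau Y Z) - Y (tau X Z) + Z (tau X Y)
  - tau (lie X Y) Z + tau (lie X Z) Y - tau (lie Y Z) X.

(* Lie derivative of a 1-form *)
Definition lie_form X eta : (C -> C) -> C :=
  fun Y => X (eta Y) - eta (lie X Y).

(** Multivector fields *)

Definition multivector (k : nat) P :=
  [/\ forall s, size s <> k -> P s = 0,
      forall s1 s2, vector_field (fun f => P (s1 ++ f :: s2)) &
      forall s1 s2 f g, P (s1 ++ f :: g :: s2) = - P (s1 ++ g :: f :: s2)].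

Definition mv_fun f : mv := fun s => if s is [::] then f else 0.

Definition mv_field X : mv := fun s => if s is [:: f] then X f else 0.

(* iota_eta P = P(eta, -, ..., -) : eta is evaluated on the vector field
   P(-, df2, ..., dfk) *)
Definition contract eta P : mv := fun s => eta (fun f => P (f :: s)).

(* All splittings of s into two complementary subsequences a and b, with the
   parity of the permutation taking s to a ++ b. *)
Fixpoint unshuffles (T : Type) (s : seq T) : seq (bool * seq T * seq T) :=
  if s is x :: s' then
    flatten [seq [:: (u.1.1, x :: u.1.2, u.2);
                     (u.1.1 (+) odd (size u.1.2), u.1.2, x :: u.2)]
            | u <- unshuffles s']
  else [:: (false, [::], [::])].

Definition wedge P Q : mv := fun s =>
  \sum_(u <- unshuffles s) (-1) ^+ u.1.1 * (P u.1.2 * Q u.2).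

(* Schouten-Nijenhuis bracket, normalized by [X, f] = X f, [X, Y] = lie X Y and
   [P, Q /\ R] = [P, Q] /\ R + (-1)^(|Q|(|P|-1)) Q /\ [P, R]. For P, Q of
   degrees p, q the only terms of the first (resp. second) kind that survive
   have |a| = q and |b| = p - 1 (resp. |a| = p and |b| = q - 1), so that the
   sign (-1)^(|b|(|a|+1)) is (-1)^((p-1)(q-1)). *)
Definition schouten P Q : mv := fun s =>
  \sum_(u <- unshuffles s) (-1) ^+ u.1.1 *
    ((-1) ^+ (size u.2 * (size u.1.2).+1)%N * P (Q u.1.2 :: u.2)
     - Q (P u.1.2 :: u.2)).

(** Distributions *)

Definition tangent_at (x : M) X : C -> R := fun f => X f x.

Definition tangent (x : M) (v : C -> R) :=
  (forall (a : R) f g, v (a *: f + g) = a * v f + v g) /\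
  (forall f g, v (f * g) = f x * v g + v f * g x).

Definition has_dim (r : nat) (S : set (C -> R)) :=
  exists b : 'I_r -> C -> R,
    (forall a : 'I_r -> R, \sum_i a i *: b i = 0 -> forall i, a i = 0) /\
    S = [set v | exists a : 'I_r -> R, v = \sum_i a i *: b i].

(* D x is a set of tangent vectors at x *)
Implicit Types D E G : M -> set (C -> R).

Definition section D : set (C -> C) :=
  [set X | vector_field X /\ forall x, D x (tangent_at x X)].

(* smooth subbundle of TM *)
Definition subbundle D :=
  [/\ forall x, D x `<=` tangent x,
      exists r, forall x, has_dim r (D x) &
      forall x v, D x v -> exists2 X, section D X & tangent_at x X = v].

Definition complement E G := forall x,
  (forall v, tangent x v -> exists u w, [/\ E x u, G x w & v = u + w]) /\
  (forall v, E x v -> G x v -> v = 0).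

(* pr : TM -> TM is the projection onto G along E, acting on vector fields *)
Definition projection E G pr := forall X,
  vector_field X -> section G (pr X) /\ section E (X \- pr X).

(** Regular Poisson structures *)

Variable Pi : mv.

Definition poisson := multivector 2 Pi /\ schouten Pi Pi = 0.

Definition sharp eta : C -> C := fun f => contract eta Pi [:: f].

Definition TF (x : M) : set (C -> R) :=
  [set v | exists2 eta, form1 eta & v = tangent_at x (sharp eta)].

Definition regular := exists r, forall x, has_dim r (TF x).

(* sections of the annihilator of TF *)
Definition annihilator : set ((C -> C) -> C) :=
  [set eta | form1 eta /\ forall X, section TF X -> eta X = 0].

(* Pi = - omega^-1: the maps T^*F -> TF induced by Pi^sharp, and
   omega^flat : TF -> T^*F are, up to sign, inverse to each other. *)
Definition leafwise_symplectic omega :=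
  [/\ form2_on (section TF) omega,
      forall eta, form1 eta -> forall X, section TF X ->
        omega (sharp eta) X = - eta X &
      forall X eta, section TF X -> form1 eta ->
        (forall Y, section TF Y -> eta Y = omega X Y) ->
        sharp eta = \- X].

Definition extension_by_zero G omega gamma :=
  [/\ form2 gamma,
      forall X Y, section TF X -> section TF Y -> gamma X Y = omega X Y &
      forall Y, section G Y -> forall X, vector_field X -> gamma Y X = 0].

Definition closed_form2 tau := forall X Y Z,
  vector_field X -> vector_field Y -> vector_field Z -> dform2 tau X Y Z = 0.

Definition d_Pi W : mv := schouten Pi W.

(* good multivector fields of degree k *)
Definition good (k : nat) : set mv :=
  [set W | multivector k W /\ forall alpha beta,
    annihilator alpha -> annihilator beta ->
    contract alpha (contract beta W) = 0].

Definition infinitesimal_deformation xi := good 2 xi /\ d_Pi xi = 0.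

(* W, of degree k.+1, is exact in the subcomplex A of (X^*(M), d_Pi) *)
Definition exact_in (A : nat -> set mv) (k : nat) W :=
  exists2 V, A k V & d_Pi V = W.

(* The characterization of [-,-]_gamma, for gamma and the projection pr onto G.
   It has degree -1 on multivector fields: the degree of [P, Q] is |P| + |Q| - 1,
   and [f, g] = 0 for functions. Only parities matter in the signs, so |P| - 1
   is written |P| + 1. *)
Record gamma_bracket gamma pr (br : mv -> mv -> mv) : Prop := GammaBracket {
  gamma_bracket_deg : forall p q r P Q, (p + q)%N = r.+1 ->
    multivector p P -> multivector q Q -> multivector r (br P Q);
  gamma_bracket_deg0 : forall P Q,
    multivector 0 P -> multivector 0 Q -> br P Q = 0;
  gamma_bracket_linear : forall p q (a : R) P P' Q,
    multivector p P -> multivector p P' -> multivector q Q ->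
    br (a *: P + P') Q = a *: br P Q + br P' Q;
  gamma_bracket_skew : forall p q P Q,
    multivector p P -> multivector q Q ->
    br P Q = - ((-1) ^+ (p.+1 * q.+1)%N *: br Q P);
  gamma_bracket_field_fun : forall X f, vector_field X ->
    br (mv_field X) (mv_fun f) = mv_fun (pr X f);
  gamma_bracket_fields : forall X Y, vector_field X -> vector_field Y ->
    br (mv_field X) (mv_field Y) =
    mv_field (lie (pr X) (pr Y)
      \- sharp (fun Z => lie_form (pr X) (gamma Y) Z
                         - lie_form (pr Y) (gamma X) Z));
  gamma_bracket_leibniz : forall p q r P Q Q',
    multivector p P -> multivector q Q -> multivector r Q' ->
    br P (wedge Q Q') =
    wedge (br P Q) Q' + (-1) ^+ (q * p.+1)%N *: wedge Q (br P Q') }.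

End Calculus.

(* Main.v *)
From HB Require Import structures.
Require Import Defs.
From mathcomp Require Import all_boot all_order all_algebra.
From mathcomp Require Import all_classical all_reals all_analysis.
From mathcomp Require Import ring.

Set Implicit Arguments.
Unset Strict Implicit.
Unset Printing Implicit Defensive.

Import Order.TTheory GRing.Theory Num.Theory.

Local Open Scope ring_scope.

(* Since TF and G have constant rank, the point derivations at each point form a
   space of constant finite dimension, so Cramer's rule provides local coframes:
   for every x there are a function d with d(x) != 0, functions u_i and vector
   fields Z_i such that d Y = sum_i Y(u_i) Z_i for all vector fields Y. Tensorial
   identities can therefore be checked on the differentials df and on the
   bivectors X /\ Y, without charts or bump functions.

   The TF-component X_F of X is given by X_F f = gamma(X, H_f), with H_f the
   Hamiltonian vector field of f. As d gamma = 0, [X, Y]_gamma - [X, Y]_SN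
   measures how far gamma-contraction is from being compatible with d_Pi; hence
   for a cocycle xi, [xi, xi]_gamma = [xi, xi]_SN + 2 d_Pi kappa, where
   kappa(f, g) = gamma(xi(df), xi(dg)). This reduces the theorem to finding a good
   primitive of [xi, xi]_gamma from an arbitrary primitive V.

   Let L be the derivation that multiplies a multivector field by its TF-degree.
   As d gamma = 0, d_Pi raises the TF-degree by exactly one, so
   d_Pi L = (L - 1) d_Pi. Now [xi, xi]_gamma has components of TF-degree 2 and 3
   only, so L (3 - L) / 2, the projection onto TF-degrees 1 and 2, maps V to a good
   primitive. *)

(** * Linear algebra: evaluation points for independent functions *)

(** The points are chosen one at a time. While k < r, the k rows found so far are all orthogonal to
    some u != 0; independence of the [b i] gives a point [t0] where sum_i u_i b_i does not vanish,
    and the row at [t0] is then independent of the others. *)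
Lemma independent_minor (F : fieldType) (T : Type) (r : nat) (b : 'I_r -> T -> F) :
  (forall a : 'I_r -> F, (forall t, \sum_i a i * b i t = 0) -> forall i, a i = 0) ->
  exists t : 'I_r -> T, \det (\matrix_(i, j) b i (t j)) != 0.
Proof.
move=> ind.
suff /(_ r (leqnn r)) [t ft] k : (k <= r)%N -> exists t : 'I_k -> T,
    row_free (\matrix_(j < k, i < r) b i (t j)).
  exists t; rewrite -det_tr -unitfE -/(_ \in unitmx) -[_ \in _]row_free_unit.
  by congr row_free : ft; apply/matrixP => i j; rewrite !mxE.
elim: k => [_|k IH kr].
  have t0 : 'I_0 -> T by case.
  by exists t0; apply: inj_row_free => v _; apply/rowP; case.
have [t ft] := IH (ltnW kr).
set N := \matrix_(j, i) b i (t j) in ft.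
have [u u0 Nu] : exists2 u : 'rV[F]_r, u != 0 & N *m u^T = 0.
  have : kermx N^T != 0.
    rewrite -mxrank_eq0 mxrank_ker mxrank_tr subn_eq0 -ltnNge.
    by move/eqP: ft => ->.
  rewrite -nz_row_eq0 => nz; exists (nz_row (kermx N^T)) => //.
  apply: trmx_inj; rewrite trmx_mul trmxK trmx0.
  by apply/sub_kermxP; exact: nz_row_sub.
have [t0 ut0] : exists t0, \sum_i u 0 i * b i t0 != 0.
  apply: contrapT => /forallNP H; case/negP: u0; apply/eqP/rowP => i.
  rewrite mxE; apply: (ind (u 0)) => t0; apply/eqP; apply: contrapT => /negP.
  exact: H.
exists (fun j : 'I_(1 + k) => if fintype.split j is inr j' then t j' else t0).
set c := \row_i b i t0.
have -> : (\matrix_(j < 1 + k, i < r) b i (if fintype.split j is inr j' then t j' else t0))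
    = col_mx c N.
  by apply/matrixP => i j; rewrite !mxE; case: (fintype.split i) => i'; rewrite !mxE.
suff inj (v1 : 'rV_1) (v2 : 'rV_k) : row_mx v1 v2 *m col_mx c N = 0 ->
    row_mx v1 v2 = 0.
  apply: inj_row_free => v vN; rewrite -[v](@hsubmxK _ _ 1 k); apply: inj.
  by rewrite hsubmxK.
rewrite mul_row_col => vN.
have cu : c *m u^T = (\sum_i u 0 i * b i t0)%:M.
  apply/matrixP => i j; rewrite !ord1 !mxE mulr1n.
  by apply: eq_bigr => l _; rewrite !mxE mulrC.
(* Multiplying the relation by u^T kills [N] and leaves [v1] times a nonzero scalar. *)
have v10 : v1 = 0.
  have := congr1 (mulmx^~ u^T) vN; rewrite /= mulmxDl -!mulmxA Nu mulmx0 addr0.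
  rewrite cu mul_mx_scalar mul0mx => /eqP.
  by rewrite scaler_eq0 (negPf ut0) => /eqP.
move: vN; rewrite v10 mul0mx add0r -{1}[N]mul1mx => vN.
have -> : v2 = 0.
  by apply: (row_free_inj ft); rewrite mul0mx -[N]mul1mx.
by rewrite row_mx0.
Qed.

(** * Smooth functions, vector fields and 1-forms *)

Section Basics.
Context {R : realType} {n : nat} {M : manifold R n}.
Notation C := (smoothFun M).
Implicit Types (f g h a : C) (X Y Z : C -> C).

(** Evaluation gets a name so that it can carry a ring morphism structure; [map_mx (eval x)] then
    commutes with determinants and adjugates. *)
Definition eval (x : M) (f : C) : R := f x.

Arguments eval : simpl never.

Lemma eval_zmod x : zmod_morphism (eval x). Proof. by []. Qed.
Lemma eval_monoid x : monoid_morphism (eval x). Proof. by []. Qed.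
HB.instance Definition _ x := GRing.isZmodMorphism.Build _ _ (eval x) (eval_zmod x).
HB.instance Definition _ x := GRing.isMonoidMorphism.Build _ _ (eval x) (eval_monoid x).

Lemma smooth_ext f g : (forall x, eval x f = eval x g) -> f = g.
Proof. by move=> fg; apply: val_inj; apply/funext. Qed.

Lemma evalM x f g : eval x (f * g) = eval x f * eval x g. Proof. by []. Qed.
Lemma evalD x f g : eval x (f + g) = eval x f + eval x g. Proof. by []. Qed.
Lemma eval0 x : eval x 0 = 0. Proof. by []. Qed.
Lemma eval1 x : eval x 1 = 1. Proof. by []. Qed.
Lemma evalZ x (c : R) f : eval x (c *: f) = c * eval x f. Proof. by []. Qed.
Lemma eval_sum x I (r : seq I) (F : I -> C) :
  eval x (\sum_(i <- r) F i) = \sum_(i <- r) eval x (F i).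
Proof. exact: rmorph_sum. Qed.

(** Turns real scalars into elements of C, so that [ring] and C-linearity apply to them. *)
Lemma scale_smooth (c : R) f : c *: f = (c *: (1 : C)) * f.
Proof. by apply: smooth_ext => x; rewrite evalM !evalZ eval1 mulr1. Qed.

(** This takes the place of localization: for each point x, an identity may be multiplied by a
    function that is nonzero at x. *)
Lemma local_eq0 f : (forall x, exists2 d : C, eval x d != 0 & d * f = 0) -> f = 0.
Proof.
move=> H; apply: smooth_ext => x; have [d dx /(congr1 (eval x))/eqP] := H x.
by rewrite evalM eval0 mulf_eq0 (negPf dx) => /eqP.
Qed.

Lemma double_eq0 f : f + f = 0 -> f = 0.
Proof.
move=> H; apply: smooth_ext => x; move/(congr1 (eval x))/eqP: H.
by rewrite evalD eval0 -mulr2n mulrn_eq0 => /eqP.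
Qed.

Lemma vfD X f g : vector_field X -> X (f + g) = X f + X g.
Proof. by case. Qed.
Lemma vfM X f g : vector_field X -> X (f * g) = f * X g + X f * g.
Proof. by case. Qed.
Lemma vf0 X : vector_field X -> X 0 = 0.
Proof. by move=> vX; apply: (addrI (X 0)); rewrite -vfD// !addr0. Qed.
Lemma vfN X f : vector_field X -> X (- f) = - X f.
Proof. by move=> vX; apply: (addrI (X f)); rewrite -vfD// !subrr vf0. Qed.
Lemma vfB X f g : vector_field X -> X (f - g) = X f - X g.
Proof. by move=> vX; rewrite vfD// vfN. Qed.

Lemma vf_comb a X Y : vector_field X -> vector_field Y ->
  vector_field (fscale a X \+ Y).
Proof.
move=> [XD XZ XM] [YD YZ YM]; rewrite /fscale; split => [f g|c f|f g] /=.
- rewrite XD YD; ring.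
- by rewrite XZ YZ scalerDr [in LHS]scale_smooth [in RHS]scale_smooth; congr +%R; ring.
- rewrite XM YM; ring.
Qed.

Lemma vf_zero : vector_field (fun _ : C => 0 : C).
Proof. by split=> *; rewrite ?scaler0 ?mulr0 ?mul0r ?addr0. Qed.

Lemma eq_vf X Y : (forall f, X f = Y f) -> vector_field X -> vector_field Y.
Proof. by move=> /funext ->. Qed.

Lemma vf_scale a X : vector_field X -> vector_field (fun f => a * X f).
Proof. by move/(vf_comb a)/(_ vf_zero); apply: eq_vf => f; exact: addr0. Qed.
Lemma vf_add X Y : vector_field X -> vector_field Y ->
  vector_field (fun f => X f + Y f).
Proof. by move/(vf_comb 1) => H /H; apply: eq_vf => f; rewrite /= /fscale mul1r. Qed.
Lemma vf_opp X : vector_field X -> vector_field (fun f => - X f).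
Proof. by move/(vf_scale (-1)); apply: eq_vf => f; rewrite mulN1r. Qed.
Lemma vf_sub X Y : vector_field X -> vector_field Y ->
  vector_field (fun f => X f - Y f).
Proof. by move=> vX /vf_opp; exact: vf_add. Qed.
Lemma vf_sumf I (r : seq I) (X : I -> C -> C) :
  (forall i, vector_field (X i)) -> vector_field (fun f => \sum_(i <- r) X i f).
Proof.
move=> vX; elim: r => [|i r IH]; first by apply: eq_vf vf_zero => f; rewrite big_nil.
by apply: eq_vf (vf_add (vX i) IH) => f; rewrite big_cons.
Qed.
Lemma vf_lie X Y : vector_field X -> vector_field Y -> vector_field (lie X Y).
Proof.
move=> vX vY; case: (vX) (vY) => [_ XZ _] [_ YZ _].
rewrite /lie; split=> [f g|c f|f g].
- rewrite !(vfD _ _ vX, vfD _ _ vY); ring.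
- by rewrite XZ YZ XZ YZ scalerBr.
- rewrite !(vfM _ _ vX, vfM _ _ vY, vfD _ _ vX, vfD _ _ vY); ring.
Qed.

Section Form1.
Variables (eta : (C -> C) -> C) (feta : form1 eta).

Lemma eq_form X Y : (forall f, X f = Y f) -> eta X = eta Y.
Proof. by move=> /funext ->. Qed.
Lemma formD X Y : vector_field X -> vector_field Y ->
  eta (fun f => X f + Y f) = eta X + eta Y.
Proof.
move=> vX vY; have := feta 1 vX vY; rewrite mul1r => <-.
by apply: eq_form => f; rewrite /= /fscale mul1r.
Qed.
Lemma form0 : eta (fun=> 0) = 0.
Proof.
by apply: (addrI (eta (fun=> 0))); rewrite -(formD vf_zero vf_zero) !addr0.
Qed.
Lemma formZ a X : vector_field X -> eta (fun f => a * X f) = a * eta X.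
Proof.
move=> vX; have := feta a vX vf_zero; rewrite form0 addr0 => <-.
by apply: eq_form => f; rewrite /= /fscale addr0.
Qed.
Lemma formN X : vector_field X -> eta (fun f => - X f) = - eta X.
Proof.
by move=> vX; rewrite -mulN1r -formZ//; apply: eq_form => f; rewrite mulN1r.
Qed.
Lemma formB X Y : vector_field X -> vector_field Y ->
  eta (fun f => X f - Y f) = eta X - eta Y.
Proof. by move=> vX vY; rewrite formD ?formN//; exact: vf_opp. Qed.
Lemma form_sum I (r : seq I) (X : I -> C -> C) :
  (forall i, vector_field (X i)) ->
  eta (fun f => \sum_(i <- r) X i f) = \sum_(i <- r) eta (X i).
Proof.
move=> vX; elim: r => [|i r IH].
  by rewrite big_nil -[RHS]form0; apply: eq_form => f; rewrite big_nil.
rewrite big_cons -IH -formD//; last exact: vf_sumf.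
by apply: eq_form => f; rewrite big_cons.
Qed.
End Form1.

Lemma form1_d f : form1 (fun X => X f). Proof. by []. Qed.

Lemma form1_comb a (eta zeta : (C -> C) -> C) : form1 eta -> form1 zeta ->
  form1 (fun X => a * eta X + zeta X).
Proof. by move=> fe fz c X Y vX vY; rewrite fe// fz//; ring. Qed.

Lemma eq_form1 (eta zeta : (C -> C) -> C) :
  (forall X, vector_field X -> eta X = zeta X) -> form1 eta -> form1 zeta.
Proof. by move=> e fe c X Y vX vY; rewrite -!e ?fe//; exact: vf_comb. Qed.

(** * Local frames *)

(** The functions and fields are global; [d] clears the denominators of Cramer's rule and is only
    asked to be nonzero at [x]. *)
Definition coframed := forall x : M, exists (d : C) (r : nat) (u : 'I_r -> C)
    (Z : 'I_r -> C -> C),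
  [/\ eval x d != 0, forall i, vector_field (Z i) &
      forall Y, vector_field Y -> forall g, d * Y g = \sum_i Y (u i) * Z i g].

Lemma tangent_vf x X : vector_field X -> tangent x (tangent_at x X).
Proof.
move=> [XD XZ XM]; split=> [c f g|f g]; rewrite /tangent_at.
  by rewrite XD XZ.
by rewrite XM.
Qed.

(** A basis of the tangent space at x, adapted to the splitting, extends to vector fields [X i], and
    functions [u j] are chosen with d = det (X i (u j)) nonzero at x. Where d does not vanish, the
    [X i] form a basis and Cramer's rule recovers the coefficients of Y from the values Y (u j). *)
Lemma coframed_complement (E D : M -> set (C -> R)) :
  (exists r, forall x, has_dim r (E x)) -> (exists r, forall x, has_dim r (D x)) ->
  (forall x v, E x v -> exists2 X, vector_field X & tangent_at x X = v) ->
  (forall x v, D x v -> exists2 X, vector_field X & tangent_at x X = v) ->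
  complement E D -> coframed.
Proof.
move=> [p Ep] [q Dq] Ev Dv cED x.
pose coord (y : M) (X : 'I_(p + q) -> C -> R) :=
  forall v, tangent y v -> exists c : 'I_(p + q) -> R,
    forall f, v f = \sum_i c i * X i f.
have basis y : exists b : 'I_(p + q) -> C -> R, [/\ coord y b,
    forall i, exists2 X, vector_field X & tangent_at y X = b i &
    forall c : 'I_(p + q) -> R, (forall f, \sum_i c i * b i f = 0) ->
      forall i, c i = 0].
  have [b [bi Eb]] := Ep y; have [b' [bi' Db]] := Dq y.
  exists (fun i => match fintype.split i with inl j => b j | inr j => b' j end).
  have [cs cI] := cED y; split.
  - move=> v /cs[u [w []]]; rewrite Eb Db => -[c ->] [c' ->] ->.
    exists (fun i => match fintype.split i with inl j => c j | inr j => c' j end) => f.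
    rewrite big_split_ord /= !fct_sumE; congr +%R.
      by apply: eq_bigr => i _; rewrite (unsplitK (inl i)).
    by apply: eq_bigr => i _; rewrite (unsplitK (inr i)).
  - move=> i; case: (fintype.split i) => j.
    + apply: Ev; rewrite Eb; exists (fun k => (k == j)%:R).
      rewrite (bigD1 j)//= eqxx scale1r big1 ?addr0// => k /negPf ->.
      by rewrite scale0r.
    + apply: Dv; rewrite Db; exists (fun k => (k == j)%:R).
      rewrite (bigD1 j)//= eqxx scale1r big1 ?addr0// => k /negPf ->.
      by rewrite scale0r.
  - move=> c c0.
    pose u := \sum_i c (lshift q i) *: b i; pose w := \sum_i c (rshift p i) *: b' i.
    have uw : u = - w.
      apply/eqP; rewrite -addr_eq0; apply/eqP/funext => f.
      have := c0 f; rewrite big_split_ord /= /u /w !fct_sumE => c0f.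
      rewrite -[RHS]c0f; congr +%R.
        by apply: eq_bigr => i _; rewrite (unsplitK (inl i)).
      by apply: eq_bigr => i _; rewrite (unsplitK (inr i)).
    have u0 : u = 0.
      apply: cI; first by rewrite Eb; exists (fun i => c (lshift q i)).
      rewrite uw Db; exists (fun i => - c (rshift p i)).
      by rewrite /w -sumrN; apply: eq_bigr => i _; rewrite scaleNr.
    have w0 : w = 0 by apply: oppr_inj; rewrite -uw u0 oppr0.
    move=> i; rewrite -(splitK i); case: (fintype.split i) => j /=.
      exact: (bi (fun i => c (lshift q i))).
    exact: (bi' (fun i => c (rshift p i))).
have [b [_ bX bi]] := basis x.
have [X XP] := boolp.choice (fun i => let: ex_intro2 X vX Xb := bX i in
                               ex_intro (fun X => _ /\ _) X (conj vX Xb)).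
have [u ub] := independent_minor bi.
pose A := \matrix_(i, j) X i (u j).
have Ay y : map_mx (eval y) A = \matrix_(i, j) tangent_at y (X i) (u j).
  by apply/matrixP => i j; rewrite !mxE.
pose d := \det A.
pose Z (j : 'I_(p + q)) g := d * \sum_i \adj A j i * X i g.
(* The second factor d makes both sides vanish at the zeros of d, where the [X i] need not span. *)
exists (d * d), (p + q)%N, u, Z; split.
- have dx : eval x d != 0.
    rewrite -det_map_mx Ay; congr (\det _ != 0) : ub; apply/matrixP => i j.
    by rewrite !mxE; case: (XP i) => _ ->.
  by rewrite evalM mulf_neq0.
- move=> j; apply/vf_scale/vf_sumf => i; apply: vf_scale; exact: (XP i).1.
- move=> Y vY g; apply: smooth_ext => y.
  rewrite -mulrA evalM.
  have -> : \sum_i Y (u i) * Z i g =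
      d * \sum_i Y (u i) * \sum_k \adj A i k * X k g.
    by rewrite big_distrr; apply: eq_bigr => i _; rewrite /Z /=; ring.
  rewrite [RHS]evalM.
  have [->|dy] := eqVneq (eval y d) 0; first by rewrite !mul0r.
  congr *%R.
  (* Constant rank enters here: the basis at y also has p + q elements, so the matrix [m'] of the
     [X i] in it is square, and d(y) != 0 makes it invertible. *)
  have [e [eT _ _]] := basis y.
  have [m mP] := boolp.choice (fun i => eT _ (tangent_vf y (XP i).1)).
  pose m' := \matrix_(i, k) m i k; pose E' := \matrix_(k, j) e k (u j).
  have AmE : map_mx (eval y) A = m' *m E'.
    rewrite Ay; apply/matrixP => i j; rewrite !mxE mP.
    by apply: eq_bigr => k _; rewrite !mxE.
  have um : m' \in unitmx.
    move: dy; rewrite -det_map_mx AmE det_mulmx mulf_eq0 negb_or => /andP[mu _].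
    by rewrite unitmxE unitfE.
  have [c cP] := eT _ (tangent_vf y vY).
  pose a := (\row_i c i) *m invmx m'.
  have Ya h : eval y (Y h) = \sum_i a 0 i * eval y (X i h).
    have -> : eval y (Y h) = ((\row_i c i) *m \col_k e k h) 0 0.
      by rewrite [LHS]cP !mxE; apply: eq_bigr => k _; rewrite !mxE.
    rewrite -[\row_i c i](mulmxKV um) -/a -mulmxA mxE.
    apply: eq_bigr => i _; congr *%R; rewrite !mxE [RHS]mP.
    by apply: eq_bigr => k _; rewrite !mxE.
  have YA : \row_j eval y (Y (u j)) = a *m map_mx (eval y) A.
    by apply/rowP => j; rewrite !mxE Ya; apply: eq_bigr => i _; rewrite !mxE.
  rewrite evalM [RHS]eval_sum.
  (* Cramer's rule: since A adj(A) = d, the row of the Y (u j) times adj(A) is d times the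
     coefficient row [a]. *)
  transitivity ((\row_j eval y (Y (u j)) *m map_mx (eval y) (\adj A)
                 *m \col_k eval y (X k g)) 0 0).
    rewrite YA -(mulmxA a) map_mx_adj mul_mx_adj det_map_mx mul_mx_scalar Ya.
    rewrite mxE -[_ (\det A)]/(eval y d) mulr_sumr; apply: eq_bigr => i _.
    by rewrite [(_ *: a) _ _]mxE [(\col__ _) _ _]mxE mulrA.
  rewrite -mulmxA mxE; apply: eq_bigr => i _; rewrite evalM mxE; congr *%R.
  by rewrite mxE eval_sum; apply: eq_bigr => k _; rewrite evalM !mxE.
Qed.

End Basics.

(** * Multivector fields of low degree *)

Section Multivectors.
Context {R : realType} {n : nat} {M : manifold R n}.
Notation C := (smoothFun M).
Notation mv := (seq C -> C).
Implicit Types (f g h a : C) (X Y Z : C -> C) (P Q W : mv).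

Lemma mv_size k P s : multivector k P -> size s != k -> P s = 0.
Proof. by case=> P0 _ _ /eqP /P0. Qed.

Lemma eq_mv k P Q : (forall s, size s != k -> P s = 0) ->
  (forall s, size s != k -> Q s = 0) ->
  (forall s, size s = k -> P s = Q s) -> P = Q.
Proof.
move=> P0 Q0 PQ; apply/funext => s; case: (eqVneq (size s) k) => sk.
  exact: PQ.
by rewrite P0 ?Q0.
Qed.

Lemma eq_mv2 P Q : (forall s, size s != 2 -> P s = 0) ->
  (forall s, size s != 2 -> Q s = 0) ->
  (forall f g, P [:: f; g] = Q [:: f; g]) -> P = Q.
Proof. by move=> P0 Q0 PQ; apply: (eq_mv P0 Q0) => -[|f[|g[|]]]. Qed.

Lemma eq_mv3 P Q : (forall s, size s != 3 -> P s = 0) ->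
  (forall s, size s != 3 -> Q s = 0) ->
  (forall f g h, P [:: f; g; h] = Q [:: f; g; h]) -> P = Q.
Proof. by move=> P0 Q0 PQ; apply: (eq_mv P0 Q0) => -[|f[|g[|h[|]]]]. Qed.

Lemma mv2_skew P f g : multivector 2 P -> P [:: f; g] = - P [:: g; f].
Proof. by case=> _ _ /(_ [::] [::] f g). Qed.
Lemma vf_mv2r P f : multivector 2 P -> vector_field (fun g => P [:: f; g]).
Proof. by case=> _ /(_ [:: f] [::]). Qed.
Lemma vf_mv2l P g : multivector 2 P -> vector_field (fun f => P [:: f; g]).
Proof. by case=> _ /(_ [::] [:: g]). Qed.

Lemma vf_mv3 P f g : multivector 3 P -> vector_field (fun h => P [:: f; g; h]).
Proof. by case=> _ /(_ [:: f; g] [::]). Qed.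
Lemma vf_mv3m P f g : multivector 3 P -> vector_field (fun h => P [:: f; h; g]).
Proof. by case=> _ /(_ [:: f] [:: g]). Qed.

Definition bivector (B : C -> C -> C) : mv :=
  fun s => if s is [:: f; g] then B f g else 0.

Lemma bivector_mv (B : C -> C -> C) : (forall f, vector_field (B f)) ->
  (forall f g, B f g = - B g f) -> multivector 2 (bivector B).
Proof.
move=> vB sB; have vB' g : vector_field (fun f => B f g).
  by apply: eq_vf (vf_opp (vB g)) => f; rewrite [RHS]sB.
split=> [[|f[|g[|]]]//|s1 s2|[|f[|g s1]] s2 f' g'] /=.
- move: s1 s2 => [|f[|g[|h s1]]] [|f'[|g' s2]] /=;
    do ?[exact: vf_zero|exact: vB|exact: vB'].
- by case: s2 => [|h s2] /=; rewrite ?oppr0.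
- by rewrite oppr0.
- by case: s1 => [|? ?]; rewrite oppr0.
Qed.

Lemma mv_fun_mv a : multivector 0 (mv_fun a).
Proof.
split=> [[]//|[|? ?] s2|[|? ?] s2 f g] //=; rewrite ?oppr0//; exact: vf_zero.
Qed.

Lemma mv_field_mv X : vector_field X -> multivector 1 (mv_field X).
Proof.
move=> vX; split=> [[|?[]]//|[|? [|? ?]] [|? ?]|[|? [|? ?]] s2 f g] //=;
  rewrite ?oppr0//; exact: vf_zero.
Qed.

Lemma mvDE P Q s : (P + Q) s = P s + Q s. Proof. by []. Qed.
Lemma mvZE (c : R) P s : (c *: P) s = c *: P s. Proof. by []. Qed.

Lemma mv_comb k (c : R) P Q : multivector k P -> multivector k Q ->
  multivector k (c *: P + Q).
Proof.
move=> mP mQ; split=> [s /eqP sk|s1 s2|s1 s2 f g].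
- by rewrite mvDE mvZE (mv_size mP)// (mv_size mQ)// scaler0 addr0.
- apply: (@eq_vf _ _ _ (fscale (c *: (1 : C)) (fun f => P (s1 ++ f :: s2)) \+
                       (fun f => Q (s1 ++ f :: s2)))) => [f|].
    by rewrite /= /fscale -scale_smooth mvDE mvZE.
  by apply: vf_comb; [case: mP|case: mQ].
- rewrite !mvDE !mvZE; case: mP mQ => _ _ -> [_ _ ->].
  by rewrite scalerN opprD.
Qed.

Lemma mv_scale k (c : R) P : multivector k P -> multivector k (c *: P).
Proof.
have z : multivector k (0 : mv).
  by split=> *; rewrite /GRing.zero//= ?oppr0//; exact: vf_zero.
by move/(mv_comb c)/(_ z); rewrite addr0.
Qed.

Lemma mv_add k P Q : multivector k P -> multivector k Q -> multivector k (P + Q).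
Proof. by move/(mv_comb 1) => H /H; rewrite scale1r. Qed.

(** * Wedge products and Schouten brackets in low degree *)

Lemma unshuffles_size (s : seq C) u :
  u \in unshuffles s -> (size u.1.2 + size u.2)%N = size s.
Proof.
elim: s u => [|x s IH] u /=; first by rewrite inE => /eqP ->.
move=> /flattenP[_ /mapP[[[b s1] s2] /IH /= <- ->]].
by rewrite !inE => /orP[]/eqP -> /=; rewrite ?addSn ?addnS.
Qed.

Lemma big_unshuffles0 s (F : bool * seq C * seq C -> C) :
  (forall u, (size u.1.2 + size u.2)%N = size s -> F u = 0) ->
  \sum_(u <- unshuffles s) F u = 0.
Proof.
by move=> F0; rewrite big_seq big1// => u /unshuffles_size; exact: F0.
Qed.

Lemma wedge_size p q P Q s : multivector p P -> multivector q Q ->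
  size s != (p + q)%N -> wedge P Q s = 0.
Proof.
move=> mP mQ sE; apply: big_unshuffles0 => u us.
have [up|up] := eqVneq (size u.1.2) p; last by rewrite (mv_size mP)// mul0r mulr0.
rewrite (mv_size mQ) ?mulr0//; apply: contra_neq sE.
by rewrite -us up => ->.
Qed.

Lemma wedge_fun a Q : wedge (mv_fun a) Q = fun s => a * Q s.
Proof.
apply/funext => s; elim: s Q => [|x s IH] Q.
  by rewrite /wedge /= big_cons big_nil /=; ring.
rewrite /wedge /= big_flatten big_map -(IH (fun s => Q (x :: s))).
apply: eq_bigr => -[[b [|y s1]] s2] _; rewrite !big_cons big_nil /= ?addbF; ring.
Qed.

Lemma wedge_fields X Y f g :
  wedge (mv_field X) (mv_field Y) [:: f; g] = X f * Y g - X g * Y f.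
Proof. by rewrite /wedge /= !big_cons big_nil /=; ring. Qed.

Lemma wedge_fields_mv X Y : vector_field X -> vector_field Y ->
  multivector 2 (wedge (mv_field X) (mv_field Y)).
Proof.
move=> vX vY.
have -> : wedge (mv_field X) (mv_field Y) =
    bivector (fun f g => X f * Y g - X g * Y f).
  apply: eq_mv2 => [s|[|?[|?[|]]]//|f g]; last exact: wedge_fields.
  by apply: wedge_size; exact: mv_field_mv.
apply: bivector_mv => f *; last ring.
apply: eq_vf (vf_sub (vf_scale (X f) vY) (vf_scale (Y f) vX)) => g; ring.
Qed.

Lemma wedge_mv1_mv2 X Q f g h : multivector 2 Q ->
  wedge (mv_field X) Q [:: f; g; h] =
  X f * Q [:: g; h] + X g * Q [:: h; f] + X h * Q [:: f; g].
Proof.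
move=> mQ; rewrite /wedge /= !big_cons big_nil /= !(mv_size mQ (s := [:: _; _; _]))//.
rewrite (mv2_skew h f mQ); ring.
Qed.

Lemma wedge_mv2_mv1 X Q f g h : multivector 2 Q ->
  wedge Q (mv_field X) [:: f; g; h] =
  X f * Q [:: g; h] + X g * Q [:: h; f] + X h * Q [:: f; g].
Proof.
move=> mQ; rewrite /wedge /= !big_cons big_nil /=
  !(mv_size mQ (s := [:: _; _; _]))// !(mv_size mQ (s := [:: _]))//.
rewrite (mv2_skew h f mQ); ring.
Qed.

Lemma schouten_size p q r P Q s : multivector p P -> multivector q Q ->
  (p + q)%N = r.+1 -> size s != r -> schouten P Q s = 0.
Proof.
move=> mP mQ pq sE; apply: big_unshuffles0 => u us.
suff K p' q' (P' Q' : mv) : multivector p' P' -> multivector q' Q' ->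
    (p' + q')%N = r.+1 -> P' (Q' u.1.2 :: u.2) = 0.
  by rewrite (K p q)// (K q p)// 1?addnC// subr0 !mulr0.
move=> mP' mQ' pq'.
have [uq|uq] := eqVneq (size u.1.2) q'; last first.
  by rewrite (mv_size mQ')//; case: mP' => _ /(_ [::] u.2)/vf0.
rewrite (mv_size mP')//=; apply: contra_neq sE => up.
by apply: succn_inj; rewrite -us uq -pq' -up addSn addnC.
Qed.

Lemma schouten_mv2 P Q f g h : multivector 2 P -> multivector 2 Q ->
  schouten P Q [:: f; g; h] =
  P [:: f; Q [:: g; h]] + P [:: g; Q [:: h; f]] + P [:: h; Q [:: f; g]] +
  (Q [:: f; P [:: g; h]] + Q [:: g; P [:: h; f]] + Q [:: h; P [:: f; g]]).
Proof.
move=> mP mQ; rewrite /schouten /= !big_cons big_nil /=.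
rewrite !(mv_size mP (s := [:: _; _; _]))// !(mv_size mQ (s := [:: _; _; _]))//.
rewrite !(mv_size mP (s := [:: _; _; _; _]))// !(mv_size mQ (s := [:: _; _; _; _]))//.
rewrite !(mv_size mP (s := [:: _]))// !(mv_size mQ (s := [:: _]))//.
rewrite (mv2_skew h f mP) (mv2_skew h f mQ).
rewrite !(vfN _ (vf_mv2r _ mP)) !(vfN _ (vf_mv2r _ mQ)).
do ![rewrite (mv2_skew (P _) _ mQ)]; do ![rewrite (mv2_skew (Q _) _ mP)].
ring.
Qed.

End Multivectors.

(** * Reduction of tensorial identities to differentials and decomposable bivectors *)

Section LocalInduction.
Context {R : realType} {n : nat} {M : manifold R n}.
Notation C := (smoothFun M).
Notation mv := (seq C -> C).
Hypothesis cof : @coframed R n M.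

(** [F] stands for the defect of an identity that is C-linear in eta. A coframe gives d eta = sum_i
    eta(Z_i) du_i, so it suffices that the defect vanishes on differentials. The first hypothesis is
    there because values of forms off vector fields are arbitrary. *)
Lemma form1_ind (F : ((C -> C) -> C) -> C) :
  (forall eta zeta, (forall X, vector_field X -> eta X = zeta X) -> F eta = F zeta) ->
  (forall a eta zeta, form1 eta -> form1 zeta ->
    F (fun X => a * eta X + zeta X) = a * F eta + F zeta) ->
  (forall f, F (fun X => X f) = 0) ->
  forall eta, form1 eta -> F eta = 0.
Proof.
move=> Fext Flin Fd eta feta; apply: local_eq0 => x.
have [d [r [u [Z [dx vZ dY]]]]] := cof x; exists d => //.
have f0 : form1 (fun=> 0 : C) by move=> c X Y _ _; rewrite mulr0 addr0.
have F0 : F (fun=> 0) = 0.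
  apply: (addrI (F (fun=> 0))); rewrite -[X in X + F _]mul1r -Flin// !addr0.
  by apply: Fext => X _; rewrite mulr0.
have -> : d * F eta = F (fun X => d * eta X + 0) by rewrite Flin// F0 addr0.
have -> : F (fun X => d * eta X + 0) = F (fun X => \sum_i eta (Z i) * X (u i)).
  apply: Fext => X vX; rewrite addr0 -(formZ feta)//.
  under eq_form do rewrite (dY _ vX).
  rewrite (form_sum feta); last by move=> i; exact: vf_scale.
  by apply: eq_bigr => i _; rewrite (formZ feta)// mulrC.
elim: (index_enum _) => [|i s IH].
  by rewrite -[RHS]F0; apply: Fext => X _; rewrite big_nil.
have -> : F (fun X => \sum_(j <- i :: s) eta (Z j) * X (u j)) =
    F (fun X => eta (Z i) * X (u i) + \sum_(j <- s) eta (Z j) * X (u j)).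
  by apply: Fext => X _; rewrite big_cons.
rewrite Flin// ?Fd ?IH ?mulr0 ?addr0//.
elim: s {IH} => [|j s IH]; first by move=> c X Y _ _; rewrite !big_nil mulr0 addr0.
apply: eq_form1 (form1_comb (eta (Z j)) (form1_d (u j)) IH) => X _.
by rewrite big_cons.
Qed.

Section Slots.
Variable B : C -> C -> C.
Hypotheses (vB : forall f, vector_field (B f)).
Hypotheses (vB' : forall g, vector_field (fun f => B f g)).

Lemma vf_form_slot eta : form1 eta -> vector_field (fun g => eta (fun f => B f g)).
Proof.
move=> fe; split=> [f g|c f|f g].
- rewrite -(formD fe) //; apply: eq_form => h; exact: vfD.
- rewrite [RHS]scale_smooth -(formZ fe)//; apply: eq_form => h.
  by rewrite -scale_smooth; case: (vB h).
- rewrite [X in _ + X]mulrC -!(formZ fe)// -(formD fe); [|exact: vf_scale..].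
  by apply: eq_form => h; rewrite (vfM _ _ (vB h)) (mulrC g).
Qed.

(* Fubini: by the coframes it suffices to take eta = df. *)
Lemma form_swap eta zeta : form1 eta -> form1 zeta ->
  zeta (fun g => eta (fun f => B f g)) = eta (fun f => zeta (B f)).
Proof.
move=> fe fz; apply/eqP; rewrite -subr_eq0; apply/eqP; move: eta fe.
have vz : vector_field (fun f => zeta (B f)).
  split=> [f g|c f|f g].
  - rewrite -(formD fz) //; apply: eq_form => h; exact: vfD (vB' h).
  - rewrite [RHS]scale_smooth -(formZ fz)//; apply: eq_form => h.
    by rewrite -scale_smooth; case: (vB' h).
  - rewrite [X in _ + X]mulrC -!(formZ fz)// -(formD fz); [|exact: vf_scale..].
    by apply: eq_form => h; rewrite (vfM _ _ (vB' h)) (mulrC g).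
apply: form1_ind => [eta eta' e|a eta eta' fe fe'|f].
- rewrite e//; congr (_ - _); apply: eq_form => g; exact: e.
- rewrite (formD fz) ?(formZ fz); [ring|..]; first exact: vf_form_slot.
    by apply: vf_scale; exact: vf_form_slot.
  exact: vf_form_slot.
- exact: subrr.
Qed.
End Slots.

(** The coframe applied in both slots gives d^2 P = sum_ij P(u_i, u_j) Z_i (x) Z_j;
    antisymmetrizing, 2 d^2 P = sum_ij P(u_i, u_j) Z_i /\ Z_j, whence the use of [double_eq0]. *)
Lemma bivector_ind (F : mv -> C) :
  (forall P Q, multivector 2 P -> multivector 2 Q -> F (P + Q) = F P + F Q) ->
  (forall a P, multivector 2 P -> F (fun s => a * P s) = a * F P) ->
  (forall X Y, vector_field X -> vector_field Y ->
    F (wedge (mv_field X) (mv_field Y)) = 0) ->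
  forall P, multivector 2 P -> F P = 0.
Proof.
move=> FD FZ Fw P mP; apply: local_eq0 => x.
have [d [r [u [Z [dx vZ dY]]]]] := cof x; exists (d * d).
  by rewrite evalM mulf_neq0.
have z2 : multivector 2 (0 : mv) by have := mv_scale 0 mP; rewrite scale0r.
have F0 : F 0 = 0 by apply: (addrI (F 0)); rewrite -FD// !addr0.
apply: double_eq0; rewrite -mulrDl -FZ//.
pose w i j := wedge (mv_field (fun f => P [:: u i; u j] * Z i f)) (mv_field (Z j)).
have mw i j : multivector 2 (w i j) by apply: wedge_fields_mv => //; exact: vf_scale.
have wE i j f g : w i j [:: f; g] = P [:: u i; u j] * (Z i f * Z j g - Z i g * Z j f).
  by rewrite /w wedge_fields; ring.
have dP f g : d * d * P [:: f; g] = \sum_i \sum_j P [:: u i; u j] * (Z i f * Z j g).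
  rewrite -mulrA (dY _ (vf_mv2l g mP)) mulr_sumr; apply: eq_bigr => i _.
  rewrite mulrA (dY _ (vf_mv2r (u i) mP)) mulr_suml; apply: eq_bigr => j _; ring.
have -> : (fun s => (d * d + d * d) * P s) = \sum_i \sum_j w i j.
  have sw s : (\sum_i \sum_j w i j) s = \sum_i \sum_j w i j s.
    by rewrite fct_sumE; apply: eq_bigr => i _; rewrite fct_sumE.
  apply: eq_mv2 => [s s2|s s2|f g].
  - by rewrite (mv_size mP)// mulr0.
  - by rewrite sw big1// => i _; rewrite big1// => j _; rewrite (mv_size (mw i j)).
  - rewrite sw mulrDl {2}(mv2_skew f g mP) mulrN !dP -sumrB; apply: eq_bigr => i _.
    by rewrite -sumrB; apply: eq_bigr => j _; rewrite wE mulrBr.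
have sumP (I : finType) (p : I -> mv) : (forall i, multivector 2 (p i)) ->
    multivector 2 (\sum_i p i) /\ ((forall i, F (p i) = 0) -> F (\sum_i p i) = 0).
  move=> mp; elim: (index_enum _) => [|i s [IHm IHF]]; rewrite ?big_nil// big_cons.
  split; first exact: mv_add.
  by move=> pF; rewrite FD// pF IHF// addr0.
apply: (sumP _ _ _).2 => [i|i]; first exact: (sumP _ _ _).1.
by apply: (sumP _ _ _).2 => // j; apply: Fw => //; exact: vf_scale.
Qed.

End LocalInduction.

(** * Decomposition of vector fields along TF and G *)

Section Core.
Context {R : realType} {n : nat} {M : manifold R n}.
Notation C := (smoothFun M).
Notation mv := (seq C -> C).
Implicit Types (f g h a : C) (X Y Z : C -> C) (P Q W : mv).
Variables (Pi : mv) (gamma : (C -> C) -> (C -> C) -> C).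

Definition ham f : C -> C := fun g => Pi [:: f; g].
(** This is - Pi^sharp (gamma^flat X), the projection to TF along G because Pi = - omega^-1 and
    gamma vanishes on G. *)
Definition leafpart X : C -> C := fun f => gamma X (ham f).
Definition transpart X : C -> C := fun f => X f - leafpart X f.

(** G and omega do not appear below: the splitting is expressed through gamma alone. The proof of
    [corollary6p3] derives these hypotheses from the geometric ones. *)
Hypothesis cof : @coframed R n M.
Hypothesis mPi : multivector 2 Pi.
Hypothesis jacobi : forall f g h, ham f (ham g h) + ham g (ham h f) + ham h (ham f g) = 0.
Hypothesis fgamma : form2 gamma.
Hypothesis cgamma : closed_form2 gamma.
Hypothesis gamma_ham : forall f g, gamma (ham f) (ham g) = ham f g.
Hypothesis gamma_trans : forall X Y, vector_field X -> vector_field Y ->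
  gamma (transpart X) Y = 0.
Hypothesis leaf_TF : forall X f, section (TF Pi) X -> leafpart X f = X f.

Local Notation F := leafpart.
Local Notation rho := transpart.

Lemma form_gamma X : vector_field X -> form1 (gamma X).
Proof. by case: fgamma => + _; exact. Qed.
Lemma gamma_skew X Y : vector_field X -> vector_field Y -> gamma X Y = - gamma Y X.
Proof. by case: fgamma => _; exact. Qed.
Lemma form_gammal Y : vector_field Y -> form1 (fun X => gamma X Y).
Proof.
move=> vY a X Z vX vZ; rewrite !(gamma_skew _ vY)//; last exact: vf_comb.
by rewrite (form_gamma vY)//; ring.
Qed.

Lemma vf_ham f : vector_field (ham f). Proof. exact: vf_mv2r. Qed.
Lemma ham_skew f g : ham f g = - ham g f. Proof. exact: mv2_skew. Qed.
Lemma hamB f g h : ham (f - g) h = ham f h - ham g h.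
Proof. exact: vfB (vf_mv2l h mPi). Qed.
Lemma ham0 h : ham 0 h = 0.
Proof. exact: vf0 (vf_mv2l h mPi). Qed.
Lemma lie_ham f g h : lie (ham f) (ham g) h = ham (ham f g) h.
Proof.
rewrite /lie [RHS]ham_skew; apply/eqP; rewrite -addr_eq0 -(jacobi f g h).
by rewrite (ham_skew f h) (vfN _ (vf_ham g)) opprK.
Qed.

Lemma lie_skew X Y f : lie X Y f = - lie Y X f.
Proof. by rewrite /lie opprB. Qed.

(** The opposite of [sharp Pi] on 1-forms: it sends df to [- ham f], and [leafpart X] is
    [sharpf (gamma X)]. *)
Definition sharpf (eta : (C -> C) -> C) : C -> C := fun f => eta (ham f).

Lemma vf_sharpf eta : form1 eta -> vector_field (sharpf eta).
Proof.
apply: (vf_form_slot (B := fun g f => ham f g)) => h; last exact: vf_ham.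
exact: vf_mv2l.
Qed.

Lemma vf_leaf X : vector_field X -> vector_field (F X).
Proof. by move=> /form_gamma; exact: vf_sharpf. Qed.
Lemma vf_trans X : vector_field X -> vector_field (rho X).
Proof. by move=> vX; apply: vf_sub => //; exact: vf_leaf. Qed.
Hint Resolve vf_ham vf_leaf vf_trans vf_lie vf_sub vf_add vf_opp vf_scale form_gamma
  form_gammal : core.

Lemma leafE X f : gamma X (ham f) = F X f. Proof. by []. Qed.
Lemma eq_leaf X Y f : (forall g, X g = Y g) -> F X f = F Y f.
Proof. by move=> /funext ->. Qed.
Lemma leafD X Y f : vector_field X -> vector_field Y ->
  F (fun f => X f + Y f) f = F X f + F Y f.
Proof. by move=> vX vY; exact: (formD (form_gammal (vf_ham f))). Qed.
Lemma leafB X Y f : vector_field X -> vector_field Y ->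
  F (fun f => X f - Y f) f = F X f - F Y f.
Proof. by move=> vX vY; exact: (formB (form_gammal (vf_ham f))). Qed.
Lemma leafN X f : vector_field X -> F (fun f => - X f) f = - F X f.
Proof. by move=> vX; exact: (formN (form_gammal (vf_ham f))). Qed.
Lemma leafZ a X f : vector_field X -> F (fun f => a * X f) f = a * F X f.
Proof. by move=> vX; exact: (formZ (form_gammal (vf_ham f))). Qed.

Lemma gamma_transr X Y : vector_field X -> vector_field Y -> gamma X (rho Y) = 0.
Proof. by move=> vX vY; rewrite gamma_skew ?gamma_trans ?oppr0; auto. Qed.
Lemma leaf_trans X f : vector_field X -> F (rho X) f = 0.
Proof. by move=> vX; exact: gamma_trans. Qed.
Lemma trans_trans X f : vector_field X -> rho (rho X) f = rho X f.
Proof. by move=> vX; rewrite {1}/rho leaf_trans// subr0. Qed.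
Lemma leaf_ham f g : F (ham f) g = ham f g. Proof. exact: gamma_ham. Qed.
Lemma eq_trans X Y f : (forall g, X g = Y g) -> rho X f = rho Y f.
Proof. by move=> /funext ->. Qed.
Lemma transD X Y f : vector_field X -> vector_field Y ->
  rho (fun f => X f + Y f) f = rho X f + rho Y f.
Proof. by move=> vX vY; rewrite /rho leafD//; ring. Qed.
Lemma transB X Y f : vector_field X -> vector_field Y ->
  rho (fun f => X f - Y f) f = rho X f - rho Y f.
Proof. by move=> vX vY; rewrite /rho leafB//; ring. Qed.
Lemma transN X f : vector_field X -> rho (fun f => - X f) f = - rho X f.
Proof. by move=> vX; rewrite /rho leafN//; ring. Qed.
Lemma transZ a X f : vector_field X -> rho (fun f => a * X f) f = a * rho X f.
Proof. by move=> vX; rewrite /rho leafZ//; ring. Qed.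

Lemma form_trans f : form1 (fun X => rho X f).
Proof.
move=> a X Y vX vY; rewrite (eq_trans (Y := fun f => a * X f + Y f))//.
by rewrite transD ?transZ//; exact: vf_scale.
Qed.

Lemma sharpf_comb a eta zeta f :
  sharpf (fun X => a * eta X + zeta X) f = a * sharpf eta f + sharpf zeta f.
Proof. by []. Qed.

Lemma trans_sharpf eta f : form1 eta -> rho (sharpf eta) f = 0.
Proof.
move: eta; apply: (form1_ind cof) => [e z ez|a e z fe fz|g].
- by apply: eq_trans => g; apply: ez.
- rewrite transD ?transZ//; [exact: vf_sharpf..| |exact: vf_sharpf].
  by apply: vf_scale; exact: vf_sharpf.
- rewrite (eq_trans (Y := fun f => - ham g f)) => [|h]; last exact: ham_skew.
  by rewrite transN// {1}/rho leaf_ham subrr oppr0.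
Qed.

(** Involutivity of TF. The condition is C-linear in each form, since the Leibniz terms are
    multiples of fields in the image of [sharpf], which [rho] kills. It thus reduces to Hamiltonian
    fields, where [lie_ham] applies. *)
Lemma trans_lie_sharpf eta zeta f : form1 eta -> form1 zeta ->
  rho (lie (sharpf eta) (sharpf zeta)) f = 0.
Proof.
have lin (X : C -> C) : vector_field X -> (forall g, rho (lie (ham g) X) f = 0) ->
    forall eta, form1 eta -> rho (lie (sharpf eta) X) f = 0.
  move=> vX X0; apply: (form1_ind cof) => [e z ez|a e z fe fz|g].
  - by apply: eq_trans => g; rewrite /lie /sharpf !ez.
  - rewrite (eq_trans (Y := fun f => a * lie (sharpf e) X f - X a * sharpf e f +
                               lie (sharpf z) X f)); last first.
      by move=> g; rewrite /lie !sharpf_comb (vfD _ _ vX) (vfM _ _ vX); ring.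
    have ve := vf_sharpf fe; have vz := vf_sharpf fz.
    rewrite transD ?(transB (X := fun f => a * lie (sharpf e) X f)) ?transZ; auto 7.
    by rewrite trans_sharpf// mulr0 subr0.
  - rewrite (eq_trans (Y := fun f => - lie (ham g) X f)) => [|h].
      by rewrite transN ?X0 ?oppr0; auto.
    rewrite /lie /sharpf.
    by rewrite [ham (X h) g]ham_skew [ham h g]ham_skew (vfN _ vX) opprB addrC opprK.
move=> fe fz; apply: (lin) => // [|g]; first exact: vf_sharpf.
rewrite (eq_trans (Y := fun f => - lie (sharpf zeta) (ham g) f)); last exact: lie_skew.
rewrite transN; last by apply: vf_lie => //; exact: vf_sharpf.
rewrite lin ?oppr0// => k.
rewrite (eq_trans (Y := ham (ham k g))); last exact: lie_ham.
by rewrite /rho leaf_ham subrr.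
Qed.

Lemma leaf_involutive X Y f : vector_field X -> vector_field Y ->
  F (lie (F X) (F Y)) f = lie (F X) (F Y) f.
Proof.
move=> vX vY; apply/eqP; rewrite eq_sym -subr_eq0; apply/eqP.
by apply: trans_lie_sharpf; exact: form_gamma.
Qed.

(** Closedness forces G to be involutive: in d gamma (rho X, rho Y, H_f) every term but gamma
    ([rho X, rho Y], H_f) vanishes. *)
Lemma trans_involutive X Y f : vector_field X -> vector_field Y ->
  F (lie (rho X) (rho Y)) f = 0.
Proof.
move=> vX vY; rewrite /leafpart.
have := cgamma (vf_trans vX) (vf_trans vY) (vf_ham f).
rewrite /dform2 !gamma_trans ?gamma_transr; auto.
rewrite (vf0 (vf_trans vX)) (vf0 (vf_trans vY)) (vf0 (vf_ham f)).
by rewrite !(subr0, addr0, sub0r, add0r) => /eqP; rewrite oppr_eq0 => /eqP.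
Qed.

(** * The bracket [X, Y]_gamma of vector fields *)

(** For closed gamma this is [X, Y]_gamma, with the Lie derivatives of gamma replaced by leafwise
    parts of Lie brackets; see [gbracketE]. *)
Definition gbracket X Y : C -> C := fun f =>
  lie (rho X) (rho Y) f + F (lie (rho X) Y) f + F (lie X (rho Y)) f.

Lemma vf_gbracket X Y : vector_field X -> vector_field Y -> vector_field (gbracket X Y).
Proof. by move=> vX vY; do 2?[apply: vf_add]; auto. Qed.

(** By Cartan's formula the Lie derivative of gamma along [rho X] is zero, as gamma is closed and
    [rho X] lies in its kernel. This is its value on Y and H_f. *)
Lemma gamma_lie_trans X Y f : vector_field X -> vector_field Y ->
  rho X (gamma Y (ham f)) - gamma Y (lie (rho X) (ham f)) = F (lie (rho X) Y) f.
Proof.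
move=> vX vY; have := cgamma (vf_trans vX) vY (vf_ham f).
rewrite /dform2 !gamma_trans ?gamma_transr; auto.
rewrite (gamma_skew (X := lie _ (ham f)) (Y := Y)); auto.
rewrite (vf0 vY) (vf0 (vf_ham f)) !subr0 addr0 /leafpart => H0.
by apply/eqP; rewrite -subr_eq0 -[X in _ == X]H0; apply/eqP; ring.
Qed.

Lemma gbracketE X Y : vector_field X -> vector_field Y ->
  lie (rho X) (rho Y)
    \- sharp Pi (fun Z => lie_form (rho X) (gamma Y) Z - lie_form (rho Y) (gamma X) Z)
  = gbracket X Y.
Proof.
move=> vX vY; apply/funext => f; rewrite /sharp /Defs.contract /lie_form /=.
have -> : (fun g => Pi [:: g; f]) = (fun g => - ham f g).
  by apply/funext => g; exact: ham_skew.
have lieN Z : vector_field Z ->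
    lie Z (fun g => - ham f g) = (fun g => - lie Z (ham f) g).
  by move=> vZ; apply/funext => g; rewrite /lie (vfN _ vZ) opprB opprK addrC.
rewrite !lieN; auto; rewrite !(formN (form_gamma _)); auto.
rewrite !(vfN _ (vf_trans _)); auto.
rewrite /gbracket -gamma_lie_trans//.
rewrite (eq_leaf (X := lie X (rho Y)) (Y := fun f => - lie (rho Y) X f)).
  by rewrite leafN -?gamma_lie_trans; auto; ring.
exact: lie_skew.
Qed.

Lemma gbracket_skew X Y f : vector_field X -> vector_field Y ->
  gbracket X Y f = - gbracket Y X f.
Proof.
move=> vX vY; rewrite /gbracket.
rewrite (lie_skew (rho X) (rho Y)) (eq_leaf f (lie_skew (rho X) Y)).
rewrite (eq_leaf f (lie_skew X (rho Y))).
by rewrite !leafN; auto; ring.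
Qed.

Lemma gbracketDr X Y Z f : vector_field X -> vector_field Y -> vector_field Z ->
  gbracket X (fun g => Y g + Z g) f = gbracket X Y f + gbracket X Z f.
Proof.
move=> vX vY vZ; rewrite /gbracket.
have rD : rho (fun g => Y g + Z g) = (fun g => rho Y g + rho Z g).
  by apply/funext => g; rewrite transD.
have lD (U V V' : C -> C) g : vector_field U ->
    lie U (fun g => V g + V' g) g = lie U V g + lie U V' g.
  by move=> vU; rewrite /lie (vfD _ _ vU); ring.
rewrite rD (eq_leaf f (fun g => lD (rho X) Y Z g (vf_trans vX))).
rewrite (eq_leaf f (fun g => lD X (rho Y) (rho Z) g vX)) lD; auto.
by rewrite (leafD (X := lie (rho X) Y)) ?(leafD (X := lie X (rho Y))); auto; ring.
Qed.

(** The anchor is [rho]: the three summands of [gbracket] contribute (rho X)(a) rho Y, (rho X)(a) F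
    Y and X(a) F (rho Y) = 0, which add up to (rho X)(a) Y. *)
Lemma gbracketZr a X Y f : vector_field X -> vector_field Y ->
  gbracket X (fun g => a * Y g) f = a * gbracket X Y f + rho X a * Y f.
Proof.
move=> vX vY; rewrite /gbracket.
have rZ : rho (fun g => a * Y g) = (fun g => a * rho Y g).
  by apply/funext => g; rewrite transZ.
have lZ (U V : C -> C) g : vector_field U ->
    lie U (fun g => a * V g) g = a * lie U V g + U a * V g.
  by move=> vU; rewrite /lie (vfM _ _ vU); ring.
rewrite rZ (eq_leaf f (fun g => lZ (rho X) Y g (vf_trans vX))).
rewrite (eq_leaf f (fun g => lZ X (rho Y) g vX)) lZ; auto.
rewrite (leafD (X := fun g => a * lie (rho X) Y g)); auto.
rewrite (leafD (X := fun g => a * lie X (rho Y) g)) ?leafZ; auto; rewrite leaf_trans//.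
have -> : Y f = rho Y f + F Y f by rewrite /rho subrK.
ring.
Qed.

Lemma gbracketDl X Y Z f : vector_field X -> vector_field Y -> vector_field Z ->
  gbracket (fun g => Y g + Z g) X f = gbracket Y X f + gbracket Z X f.
Proof.
move=> vX vY vZ; rewrite gbracket_skew ?gbracketDr; auto.
by rewrite (gbracket_skew f vY)// (gbracket_skew f vZ)//; ring.
Qed.

Lemma gbracketZl a X Y f : vector_field X -> vector_field Y ->
  gbracket (fun g => a * X g) Y f = a * gbracket X Y f - rho Y a * X f.
Proof.
move=> vX vY; rewrite gbracket_skew ?gbracketZr; auto.
by rewrite (gbracket_skew f vX)//; ring.
Qed.

(** The fields [X, H_f] and H_(X f) differ by the contraction of L_X Pi with df. The correction to
    [lie X Y] therefore measures how contraction with gamma fails to commute with d_Pi, and it no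
    longer involves [rho]. *)
Lemma gbracket_lie X Y f : vector_field X -> vector_field Y ->
  gbracket X Y f = lie X Y f + ham f (gamma X Y)
   + (gamma (lie X (ham f)) Y - gamma (ham (X f)) Y)
   + (gamma X (lie Y (ham f)) - gamma X (ham (Y f))).
Proof.
move=> vX vY.
have lieB (U V W : C -> C) g : vector_field W ->
    lie (fun g => U g - V g) W g = lie U W g - lie V W g.
  by move=> vW; rewrite /lie (vfB _ _ vW); ring.
have lieBr (U V W : C -> C) g : vector_field W ->
    lie W (fun g => U g - V g) g = lie W U g - lie W V g.
  by move=> vW; rewrite /lie (vfB _ _ vW); ring.
have E1 : F (lie (rho X) Y) f = F (lie X Y) f - F (lie (F X) Y) f.
  by rewrite (eq_leaf f (fun g => lieB X (F X) Y g vY)) (leafB (X := lie X Y)); auto.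
have E2 : F (lie X (rho Y)) f = F (lie X Y) f - F (lie X (F Y)) f.
  by rewrite (eq_leaf f (fun g => lieBr Y (F Y) X g vX)) (leafB (X := lie X Y)); auto.
have E3 : F (lie (rho X) (rho Y)) f = F (lie X Y) f - F (lie (F X) Y) f
    - (F (lie X (F Y)) f - lie (F X) (F Y) f).
  rewrite (eq_leaf f (fun g => lieB X (F X) (rho Y) g (vf_trans vY)))
      (leafB (X := lie X (rho Y))); auto.
  rewrite E2 (eq_leaf f (fun g => lieBr Y (F Y) (F X) g (vf_leaf vX)))
      (leafB (X := lie (F X) Y)); auto.
  by rewrite leaf_involutive//; ring.
have := trans_involutive f vX vY; rewrite {}E3 => E3.
have := cgamma vX vY (vf_ham f); rewrite /dform2 !leafE => dg.
rewrite (gamma_skew (X := lie Y (ham f)) (Y := X)) in dg; auto.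
rewrite (gamma_skew (X := ham (X f)) (Y := Y)) ; auto.
rewrite !leafE /gbracket E1 E2.
(* The two sides differ by the left-hand side of [E3] (involutivity of G) minus that of [dg]
   (closedness on X, Y, H_f), both of which are zero. *)
apply/eqP; rewrite -subr_eq0 -[X in _ == X]subr0 -[X in _ == X - _]E3.
rewrite -[X in _ == _ - X]dg; apply/eqP.
rewrite /lie /rho !(vfB _ _ vX) !(vfB _ _ vY).
rewrite !(vfB _ _ (vf_leaf vX)) !(vfB _ _ (vf_leaf vY)).
ring.
Qed.

(** * The bracket of two bivectors *)

Section Bracket.
Variable br : mv -> mv -> mv.
Hypothesis brg : gamma_bracket Pi gamma rho br.

Lemma brDr p q r P Q Q' : (p + q)%N = r.+1 -> multivector p P -> multivector q Q ->
  multivector q Q' -> br P (Q + Q') = br P Q + br P Q'.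
Proof.
move=> pq mP mQ mQ'; rewrite (gamma_bracket_skew brg mP (mv_add mQ mQ')).
have := gamma_bracket_linear brg 1 mQ mQ' mP; rewrite !scale1r => ->.
by rewrite scalerDr opprD -!(gamma_bracket_skew brg).
Qed.

Lemma br_mulr p q P Q a : multivector p P -> multivector q Q ->
  br P (fun s => a * Q s) = wedge (br P (mv_fun a)) Q + (fun s => a * br P Q s).
Proof.
move=> mP mQ; rewrite -wedge_fun (gamma_bracket_leibniz brg mP (mv_fun_mv a) mQ).
by rewrite mul0n expr0 scale1r wedge_fun.
Qed.

Lemma br_fun_field a X : vector_field X ->
  br (mv_fun a) (mv_field X) = mv_fun (- rho X a).
Proof.
move=> vX; rewrite (gamma_bracket_skew brg (mv_fun_mv a) (mv_field_mv vX)).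
rewrite (gamma_bracket_field_fun brg a vX) mul1n -signr_odd expr0 scale1r.
by apply/funext => -[|f s]//=; rewrite /GRing.opp/= oppr0.
Qed.

Lemma mvNE P s : (- P) s = - P s. Proof. by []. Qed.

(** Both sides are C-linear in P, so the Leibniz rule on X /\ Y decides. *)
Lemma br_fun_mv2 a P k : multivector 2 P ->
  br (mv_fun a) P [:: k] = rho (fun g => P [:: k; g]) a.
Proof.
move=> mP; apply/eqP; rewrite -subr_eq0; apply/eqP; move: P mP.
apply: (bivector_ind cof) => [P Q mP mQ|b P mP|X Y vX vY].
- rewrite (brDr (p := 0) (q := 2) (r := 1)) ?mvDE//; last exact: mv_fun_mv.
  rewrite (eq_trans (Y := fun g => P [:: k; g] + Q [:: k; g]))//.
  rewrite transD; [|exact: vf_mv2r..].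
  ring.
- rewrite (br_mulr _ (mv_fun_mv a) mP) mvDE transZ; last exact: vf_mv2r.
  rewrite (gamma_bracket_deg0 brg); [|exact: mv_fun_mv..].
  rewrite [wedge _ _ _](_ : _ = 0) ?add0r ?mulrBr//.
  by apply: big_unshuffles0 => u _; rewrite mul0r mulr0.
- rewrite (gamma_bracket_leibniz brg (mv_fun_mv a) (mv_field_mv vX) (mv_field_mv vY)).
  rewrite !br_fun_field// wedge_fun mvDE mvZE mul1n expr1 scaleN1r.
  rewrite [rho (fun g => wedge _ _ _) a](eq_trans (Y := fun g => X k * Y g - Y k * X g));
    last first.
    by move=> g; rewrite wedge_fields; ring.
  rewrite transB ?transZ; auto.
  rewrite [wedge (mv_field X) _ _](_ : _ = X k * - rho Y a); first by rewrite /=; ring.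
  by rewrite /wedge /= !big_cons big_nil /=; ring.
Qed.

Lemma br_mv2_fun a P : multivector 2 P ->
  br P (mv_fun a) = mv_field (fun k => rho (fun g => P [:: k; g]) a).
Proof.
move=> mP; rewrite (gamma_bracket_skew brg mP (mv_fun_mv a)).
rewrite muln1 -signr_odd expr1 scaleN1r opprK.
have m1 := @gamma_bracket_deg _ _ _ _ _ _ _ brg 0 2 1 _ _ erefl (mv_fun_mv a) mP.
apply/funext => -[|k [|l s]].
- by rewrite (mv_size m1).
- by rewrite br_fun_mv2.
- by rewrite (mv_size m1).
Qed.

Lemma br_mv2_sym P Q : multivector 2 P -> multivector 2 Q -> br P Q = br Q P.
Proof.
move=> mP mQ; rewrite (gamma_bracket_skew brg mP mQ).
by rewrite -signr_odd expr1 scaleN1r opprK.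
Qed.

Definition at1 P f : C -> C := fun g => P [:: f; g].

(* For P = Q this is -[P, P]_gamma / 2; the coefficients of the two kinds of terms
   are forced by tensoriality in f, g and h. *)
Definition bracket_terms P Q f g h :=
  rho (at1 P f) (Q [:: g; h]) + rho (at1 P g) (Q [:: h; f]) + rho (at1 P h) (Q [:: f; g])
  - (gbracket (at1 P g) (at1 Q h) f + gbracket (at1 P h) (at1 Q f) g
     + gbracket (at1 P f) (at1 Q g) h).

Lemma vf_at1 P f : multivector 2 P -> vector_field (at1 P f).
Proof. exact: vf_mv2r. Qed.
Hint Resolve vf_at1 vf_gbracket : core.

Lemma at1D P Q f : at1 (P + Q) f = (fun g => at1 P f g + at1 Q f g).
Proof. by []. Qed.

Lemma bracket_termsD P Q Q' f g h :
  multivector 2 P -> multivector 2 Q -> multivector 2 Q' ->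
  bracket_terms P (Q + Q') f g h = bracket_terms P Q f g h + bracket_terms P Q' f g h.
Proof.
move=> mP mQ mQ'; rewrite /bracket_terms !mvDE !at1D !gbracketDr; auto.
by rewrite !(vfD _ _ (vf_trans (vf_at1 _ mP))); ring.
Qed.

Lemma bracket_termsDl P Q Q' f g h :
  multivector 2 P -> multivector 2 Q -> multivector 2 Q' ->
  bracket_terms (Q + Q') P f g h = bracket_terms Q P f g h + bracket_terms Q' P f g h.
Proof.
by move=> mP mQ mQ'; rewrite /bracket_terms !at1D !gbracketDl ?transD; auto; ring.
Qed.

(** The derivatives of a cancel in the first summand; in the second they produce the anchor terms
    that the Leibniz rule of [br] demands. *)
Lemma bracket_termsZ P Q a f g h : multivector 2 P -> multivector 2 Q ->
  bracket_terms P (fun s => a * Q s) f g h + bracket_terms (fun s => a * Q s) P f g h =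
  a * (bracket_terms P Q f g h + bracket_terms Q P f g h)
  - (rho (at1 P f) a * Q [:: g; h] + rho (at1 P g) a * Q [:: h; f]
     + rho (at1 P h) a * Q [:: f; g]).
Proof.
move=> mP mQ; rewrite /bracket_terms.
have aE k : at1 (fun s => a * Q s) k = (fun g => a * at1 Q k g) by [].
rewrite !aE !gbracketZr ?gbracketZl ?transZ; auto.
rewrite !(vfM _ _ (vf_trans (vf_at1 _ mP))) /at1.
rewrite (mv2_skew g f mQ) (mv2_skew h g mQ) (mv2_skew f h mQ); ring.
Qed.

Lemma br_wedge_field X Y Z : vector_field X -> vector_field Y -> vector_field Z ->
  br (wedge (mv_field X) (mv_field Y)) (mv_field Z) =
  - (wedge (mv_field (gbracket Z X)) (mv_field Y)
     + wedge (mv_field X) (mv_field (gbracket Z Y))).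
Proof.
move=> vX vY vZ.
rewrite (gamma_bracket_skew brg (wedge_fields_mv vX vY) (mv_field_mv vZ)).
rewrite -signr_odd expr0 scale1r.
rewrite (gamma_bracket_leibniz brg (mv_field_mv vZ) (mv_field_mv vX) (mv_field_mv vY)).
by rewrite -signr_odd expr0 scale1r !(gamma_bracket_fields brg)// !gbracketE.
Qed.

(** The decomposable case of [br_mv2]: the Leibniz rule expands the left side, [gB] the right one,
    and the coefficients of the brackets and anchors are compared. *)
Lemma br_wedge X Y X' Y' f g h :
  vector_field X -> vector_field Y -> vector_field X' -> vector_field Y' ->
  let P := wedge (mv_field X) (mv_field Y) in
  let Q := wedge (mv_field X') (mv_field Y') in
  br P Q [:: f; g; h] = - (bracket_terms P Q f g h + bracket_terms Q P f g h).
Proof.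
move=> vX vY vX' vY' P Q.
have mP : multivector 2 P by exact: wedge_fields_mv.
have mQ : multivector 2 Q by exact: wedge_fields_mv.
have mB Z : vector_field Z -> multivector 2 (br P (mv_field Z)).
  move=> vZ.
  exact: (@gamma_bracket_deg _ _ _ _ _ _ _ brg 2 1 2 _ _ erefl mP (mv_field_mv vZ)).
have PE U V k : at1 (wedge (mv_field U) (mv_field V)) k =
    (fun l => U k * V l - V k * U l).
  by apply/funext => l; rewrite /at1 wedge_fields; ring.
have gB U V U' V' a b c d k : vector_field U -> vector_field V ->
    vector_field U' -> vector_field V' ->
    gbracket (fun l => a * U l - b * V l) (fun l => c * U' l - d * V' l) k =
    a * c * gbracket U U' k - a * d * gbracket U V' k
    - b * c * gbracket V U' k + b * d * gbracket V V' k
    + (a * rho U c - b * rho V c) * U' k - (a * rho U d - b * rho V d) * V' k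
    - (c * rho U' a - d * rho V' a) * U k + (c * rho U' b - d * rho V' b) * V k.
  move=> vU vV vU' vV'.
  have E (r : C) (W : C -> C) l : - (r * W l) = (- r) * W l by rewrite mulNr.
  have -> : (fun l => a * U l - b * V l) = (fun l => a * U l + (- b) * V l).
    by apply/funext => l; rewrite E.
  have -> : (fun l => c * U' l - d * V' l) = (fun l => c * U' l + (- d) * V' l).
    by apply/funext => l; rewrite E.
  rewrite gbracketDl ?gbracketDr; auto 6; rewrite !gbracketZl; auto.
  rewrite !transZ; auto; rewrite !gbracketZr; auto.
  rewrite !(vfN _ (vf_trans vU)) !(vfN _ (vf_trans vV)).
  by rewrite !(vfN _ (vf_trans vU')) !(vfN _ (vf_trans vV')); ring.
rewrite (gamma_bracket_leibniz brg mP (mv_field_mv vX') (mv_field_mv vY')) mvDE mvZE.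
rewrite wedge_mv2_mv1 ?wedge_mv1_mv2; auto.
rewrite !br_wedge_field// !mvNE !mvDE !wedge_fields mul1n -signr_odd expr1 scaleN1r.
rewrite /bracket_terms /P /Q !PE !gB//.
rewrite !transB ?transZ; auto.
rewrite !wedge_fields.
rewrite !(vfB _ _ (vf_trans vX), vfB _ _ (vf_trans vY), vfB _ _ (vf_trans vX'),
          vfB _ _ (vf_trans vY'), vfM _ _ (vf_trans vX), vfM _ _ (vf_trans vY),
          vfM _ _ (vf_trans vX'), vfM _ _ (vf_trans vY')).
rewrite !(gbracket_skew _ vX' vX) !(gbracket_skew _ vX' vY).
rewrite !(gbracket_skew _ vY' vX) !(gbracket_skew _ vY' vY).
ring.
Qed.

(** [main] reduces the second argument to decomposable bivectors; it serves for the first one as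
    well, since [br] is symmetric on bivectors. *)
Lemma br_mv2 P Q f g h : multivector 2 P -> multivector 2 Q ->
  br P Q [:: f; g; h] = - (bracket_terms P Q f g h + bracket_terms Q P f g h).
Proof.
have main P0 : multivector 2 P0 ->
    (forall X Y, vector_field X -> vector_field Y ->
      let Q := wedge (mv_field X) (mv_field Y) in
      br P0 Q [:: f; g; h] = - (bracket_terms P0 Q f g h + bracket_terms Q P0 f g h)) ->
    forall Q, multivector 2 Q ->
      br P0 Q [:: f; g; h] = - (bracket_terms P0 Q f g h + bracket_terms Q P0 f g h).
  move=> mP H Q0 mQ; apply/eqP; rewrite -subr_eq0; apply/eqP; move: Q0 mQ.
  apply: (bivector_ind cof) => [P1 P2 mP1 mP2|b P1 mP1|X Y vX vY].
  - rewrite (brDr (p := 2) (q := 2) (r := 3))// mvDE bracket_termsD// bracket_termsDl//.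
    ring.
  - rewrite (br_mulr _ mP mP1) mvDE bracket_termsZ// br_mv2_fun// wedge_mv1_mv2//.
    rewrite /at1; ring.
  - by rewrite H// subrr.
move=> mP mQ; apply: (main) => // X Y vX vY Q'.
have mQ' : multivector 2 Q' by exact: wedge_fields_mv.
rewrite br_mv2_sym// addrC; move: P mP; apply: (main) => // X' Y' vX' vY'.
exact: br_wedge.
Qed.

End Bracket.

(** * The primitive of the difference of the two brackets *)

Definition at2 W f g : C -> C := fun h => W [:: f; g; h].

Lemma dPi_at2 V f g h : multivector 2 V -> at2 (schouten Pi V) f g h =
  lie (ham f) (at1 V g) h + lie (at1 V f) (ham g) h - ham (V [:: f; g]) h
  - at1 V (ham f g) h.
Proof.
move=> mV; rewrite /at2 schouten_mv2// -!/(ham _ _).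
rewrite (ham_skew h (V _)) (ham_skew h f) (mv2_skew h f mV).
rewrite (mv2_skew h (ham f g) mV) (vfN _ (vf_ham g)) (vfN _ (vf_mv2r g mV)).
rewrite /lie /at1; ring.
Qed.

Section Cocycle.
Variable xi : mv.
Hypothesis mxi : multivector 2 xi.
Hypothesis cxi : schouten Pi xi = 0.

(** The bivector kappa of the header. *)
Definition gamma_square : mv := bivector (fun f g => gamma (at1 xi f) (at1 xi g)).

Lemma vf_at1_form P eta : multivector 2 P -> form1 eta ->
  vector_field (fun g => eta (at1 P g)).
Proof.
move=> mP; apply: (vf_form_slot (B := fun f g => P [:: g; f])) => h.
  exact: vf_mv2l.
exact: vf_mv2r.
Qed.

Lemma gamma_square_mv : multivector 2 gamma_square.
Proof.
apply: bivector_mv => [f|f g]; last by apply: gamma_skew; exact: vf_at1.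
by apply: vf_at1_form => //; apply: form_gamma; exact: vf_at1.
Qed.

Lemma cocycle_at1 f g h : at1 xi (ham f g) h =
  lie (ham f) (at1 xi g) h + lie (at1 xi f) (ham g) h - ham (xi [:: f; g]) h.
Proof.
have := dPi_at2 f g h mxi; rewrite cxi => E.
by apply/eqP; rewrite eq_sym -subr_eq0 -E.
Qed.

(** [gbracket_lie] for the fields xi(dg) and xi(dh), arranged so that its gamma terms match those
    into which [cocycle_at1] turns d_Pi kappa. *)
Lemma gbracket_at1 f g h : gbracket (at1 xi g) (at1 xi h) f =
  xi [:: g; xi [:: h; f]] + xi [:: h; xi [:: f; g]] + ham f (gamma_square [:: g; h])
  + gamma (at1 xi h) (lie (ham f) (at1 xi g)) - gamma (at1 xi h) (ham (xi [:: f; g]))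
  + gamma (at1 xi g) (lie (at1 xi h) (ham f)) - gamma (at1 xi g) (ham (xi [:: h; f])).
Proof.
have v := fun k => vf_at1 k mxi.
rewrite gbracket_lie//.
rewrite (gamma_skew (X := lie (at1 xi g) (ham f)) (Y := at1 xi h)); auto.
rewrite (gamma_skew (X := ham _) (Y := at1 xi h)); auto.
have -> : lie (at1 xi g) (ham f) = (fun k => - lie (ham f) (at1 xi g) k).
  by apply/funext => k; exact: lie_skew.
have -> : ham (at1 xi g f) = (fun k => - ham (xi [:: f; g]) k).
  apply/funext => k; rewrite /at1 (mv2_skew g f mxi).
  by rewrite -[RHS]sub0r -(ham0 k) -hamB sub0r.
rewrite !(formN (form_gamma _)); auto.
rewrite /lie /at1 /= (mv2_skew g f mxi) (vfN _ (vf_mv2r h mxi)); ring.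
Qed.

Lemma bracket_terms_cocycle f g h : bracket_terms xi xi f g h =
  - (xi [:: f; xi [:: g; h]] + xi [:: g; xi [:: h; f]] + xi [:: h; xi [:: f; g]])
  - schouten Pi gamma_square [:: f; g; h].
Proof.
have v := fun k => vf_at1 k mxi.
(* The cocycle condition, inserted in the second slot of kappa. *)
have sq k f' g' : gamma_square [:: k; ham f' g'] =
    gamma (at1 xi k) (lie (ham f') (at1 xi g'))
    + gamma (at1 xi k) (lie (at1 xi f') (ham g'))
    - gamma (at1 xi k) (ham (xi [:: f'; g'])).
  rewrite /=; have -> : at1 xi (ham f' g') = (fun h => lie (ham f') (at1 xi g') h
      + lie (at1 xi f') (ham g') h - ham (xi [:: f'; g']) h).
    by apply/funext => l; exact: cocycle_at1.
  have fx := form_gamma (v k).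
  have v1 := vf_lie (vf_ham f') (v g'); have v2 := vf_lie (v f') (vf_ham g').
  by rewrite (formB fx (vf_add v1 v2) (vf_ham _)) (formD fx v1 v2).
rewrite schouten_mv2//; last exact: gamma_square_mv.
rewrite -!/(ham _ _) !sq /bracket_terms !gbracket_at1 /transpart -!leafE /at1.
ring.
Qed.

End Cocycle.

Lemma br_cocycle br xi : gamma_bracket Pi gamma rho br -> multivector 2 xi ->
  schouten Pi xi = 0 ->
  br xi xi =
    schouten xi xi + (schouten Pi (gamma_square xi) + schouten Pi (gamma_square xi)).
Proof.
move=> brg mxi cxi; have mk := gamma_square_mv mxi.
apply: eq_mv3 => [s|s s3|f g h].
- exact: (mv_size (@gamma_bracket_deg _ _ _ _ _ _ _ brg 2 2 3 _ _ erefl mxi mxi)).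
- rewrite !mvDE (schouten_size mxi mxi (r := 3))//.
  by rewrite (schouten_size mPi mk (r := 3))// !addr0.
- rewrite !mvDE (br_mv2 brg)// bracket_terms_cocycle// (schouten_mv2 _ _ _ mxi mxi); ring.
Qed.

(** * The leafwise degree operator *)

(* The derivation L of the header, on bivectors. *)
Definition leafop V : mv := bivector (fun f g => F (at1 V f) g - F (at1 V g) f).

Lemma leafop_mv V : multivector 2 V -> multivector 2 (leafop V).
Proof.
move=> mV; apply: bivector_mv => [f|f g]; last by rewrite opprB.
apply: vf_sub; first by apply: vf_leaf; exact: vf_at1.
exact: (vf_at1_form mV (form_gammal (vf_ham f))).
Qed.

(** This is d_Pi L = (L - 1) d_Pi on bivectors: the sum of the three [F] terms is L W. *)
Lemma schouten_leafop V f g h : multivector 2 V ->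
  let W := schouten Pi V in
  schouten Pi (leafop V) [:: f; g; h] =
  F (at2 W f g) h + F (at2 W g h) f + F (at2 W h f) g - W [:: f; g; h].
Proof.
move=> mV W; have v k := vf_at1 k mV.
have leafW f' g' h' : F (at2 W f' g') h' =
    - F (lie (at1 V g') (ham f')) h' + F (lie (at1 V f') (ham g')) h'
    - ham (V [:: f'; g']) h' - F (at1 V (ham f' g')) h'.
  have v1 := vf_lie (vf_ham f') (v g'); have v2 := vf_lie (v f') (vf_ham g').
  rewrite (eq_leaf h' (fun k => dPi_at2 f' g' k mV)).
  rewrite (leafB h' (vf_sub (vf_add v1 v2) (vf_ham _)) (v _)).
  rewrite (leafB h' (vf_add v1 v2) (vf_ham _)) (leafD h' v1 v2) leaf_ham.
  rewrite (eq_leaf h' (fun k => lie_skew (ham f') (at1 V g') k)).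
  by rewrite (leafN h' (vf_lie (v g') (vf_ham f'))).
(* Closedness of gamma on V(df'), H_g' and H_h'. *)
have closed f' g' h' : F (lie (at1 V f') (ham g')) h' - F (lie (at1 V f') (ham h')) g' =
    V [:: f'; ham g' h'] - ham g' (F (at1 V f') h') + ham h' (F (at1 V f') g')
    + F (at1 V f') (ham g' h').
  have := cgamma (v f') (vf_ham g') (vf_ham h'); rewrite /dform2.
  have -> : lie (ham g') (ham h') = ham (ham g' h').
    by apply/funext => k; exact: lie_ham.
  rewrite gamma_ham (gamma_skew (vf_ham (ham g' h')) (v f')) !leafE /at1 => E.
  by apply/eqP; rewrite -subr_eq0 -oppr_eq0 -[X in _ == X]E; apply/eqP; ring.
have mL := leafop_mv mV.
rewrite !leafW schouten_mv2// /W schouten_mv2// -!/(ham _ _) /=.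
rewrite !(vfB _ _ (vf_ham _)).
have := closed f g h; have := closed g h f; have := closed h f g.
rewrite (ham_skew (V _) h) (ham_skew (V _) f) (ham_skew (V _) g) => E1 E2 E3.
(* The six leafwise parts of brackets are made opaque, so that the three closedness relations
   eliminate three of them and [ring] does the rest. *)
set a1 := F (lie _ _) _ in E1 *; set a2 := F (lie _ _) _ in E1 *.
set a3 := F (lie _ _) _ in E2 *; set a4 := F (lie _ _) _ in E2 *.
set a5 := F (lie _ _) _ in E3 *; set a6 := F (lie _ _) _ in E3 *.
move/eqP: E1; rewrite subr_eq => /eqP ->.
move/eqP: E2; rewrite subr_eq => /eqP ->.
move/eqP: E3; rewrite subr_eq => /eqP ->.
rewrite /at1; ring.
Qed.

(** On trivectors the TF-degree is 3 minus the G-degree, so L - 1 becomes 2 minus the sum of the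
    projections of one slot to G. *)
Lemma schouten_leafop_trans V f g h : multivector 2 V ->
  let W := schouten Pi V in
  schouten Pi (leafop V) [:: f; g; h] = W [:: f; g; h] + W [:: f; g; h]
  - (rho (at2 W f g) h + rho (at2 W g h) f + rho (at2 W h f) g).
Proof.
move=> mV W; rewrite schouten_leafop// -/W /transpart /at2.
have c f' g' h' : W [:: f'; g'; h'] = W [:: g'; h'; f'].
  by rewrite /W !schouten_mv2//; ring.
rewrite (c h f g) -(c f g h); ring.
Qed.

Lemma TF_leaf X : vector_field X -> section (TF Pi) (F X).
Proof.
move=> vX; split=> [|x]; first exact: vf_leaf.
exists (fun Y => - gamma X Y).
  by move=> a Y Z vY vZ; rewrite (form_gamma vX)//; ring.
apply/funext => f; rewrite /tangent_at /sharp /Defs.contract.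
have -> : (fun g => Pi [:: g; f]) = (fun g => - ham f g).
  by apply/funext => g; exact: ham_skew.
by rewrite (formN (form_gamma vX))// opprK.
Qed.

Lemma annihilator_leaf alpha X : annihilator Pi alpha -> vector_field X ->
  alpha (F X) = 0.
Proof. by case=> _ + vX; apply; exact: TF_leaf. Qed.

Lemma annihilator_trans f : annihilator Pi (fun X => rho X f).
Proof.
split; first exact: form_trans.
by move=> X TX; rewrite /transpart leaf_TF// subrr.
Qed.

(** Each summand of [leafop V] has one slot projected to TF, which annihilators kill; [form_swap]
    exposes this slot in the summand where it is hit by alpha. *)
Lemma leafop_good V : multivector 2 V -> good Pi 2 (leafop V).
Proof.
move=> mV; split; first exact: leafop_mv.
move=> alpha beta aa ab; have [fa _] := aa; have [fb _] := ab.
apply/funext => -[|h s]; rewrite /Defs.contract; last first.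
  have z (eta : (C -> C) -> C) : form1 eta -> eta (fun=> 0) = 0 by exact: form0.
  have -> : (fun f => beta (fun g => leafop V [:: g, f, h & s])) = (fun=> 0).
    by apply/funext => f; exact: z.
  exact: z.
have v k := vf_at1 k mV.
have vl k : vector_field (fun g => F (at1 V g) k).
  exact: (vf_at1_form mV (form_gammal (vf_ham k))).
have -> : (fun f => beta (fun g => leafop V [:: g; f])) =
    (fun f => beta (fun g => F (at1 V g) f)).
  apply/funext => f; rewrite (formB fb (vl f) (vf_leaf (v f))).
  by rewrite (annihilator_leaf ab (v f)) subr0.
rewrite (form_swap cof (B := fun g f => F (at1 V g) f) _ vl fb fa) => [|k]; last first.
  exact: vf_leaf.
have -> : (fun g => alpha (F (at1 V g))) = (fun=> 0).
  by apply/funext => g; exact: annihilator_leaf.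
exact: form0.
Qed.

Lemma leafopZ (c : R) V : multivector 2 V -> leafop (c *: V) = c *: leafop V.
Proof.
move=> mV; have v k := vf_at1 k mV.
have L0 U s : size s != 2 -> leafop U s = 0 by move: s => [|?[|?[|? ?]]].
apply: eq_mv2 => [s|s s2|f g]; [exact: L0|by rewrite mvZE L0 ?scaler0|rewrite mvZE /=].
have e k : at1 (c *: V) k = (fun l => (c *: (1 : C)) * at1 V k l).
  by apply/funext => l; rewrite /at1 mvZE -scale_smooth.
by rewrite !e !leafZ// [RHS]scale_smooth mulrBr.
Qed.

Lemma schoutenZ (c : R) V : multivector 2 V -> schouten Pi (c *: V) = c *: schouten Pi V.
Proof.
move=> mV; have mcV := mv_scale c mV.
apply: eq_mv3 => [s s3|s s3|f g h].
- exact: (schouten_size mPi mcV (r := 3)).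
- by rewrite mvZE (schouten_size mPi mV (r := 3))// scaler0.
- rewrite mvZE !schouten_mv2// !mvZE -!/(ham _ _).
  have hZ k l : ham k (c *: l) = c *: ham k l by case: (vf_ham k).
  by rewrite !hZ !scalerDr.
Qed.

Lemma schoutenD U V : multivector 2 U -> multivector 2 V ->
  schouten Pi (U + V) = schouten Pi U + schouten Pi V.
Proof.
move=> mU mV; have mUV := mv_add mU mV.
apply: eq_mv3 => [s s3|s s3|f g h].
- exact: (schouten_size mPi mUV (r := 3)).
- rewrite mvDE (schouten_size mPi mU (r := 3))//.
  by rewrite (schouten_size mPi mV (r := 3))// addr0.
- rewrite mvDE !schouten_mv2// !mvDE -!/(ham _ _) !(vfD _ _ (vf_ham _)); ring.
Qed.

(** The hypothesis on W = d_Pi V says that at most one slot of W is transverse: only TF-degrees 2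
    and 3 occur. With V1 = (3 - L) V one gets d_Pi V1 = (4 - L) W and d_Pi (L V1) = (L - 1)(4 - L)
    W, and (L - 1)(4 - L) takes the value 2 at both degrees. So L V1 / 2 is a primitive of W, good
    by [leafop_good]. *)
Lemma exact_good V : multivector 2 V ->
  (forall f g h, rho (fun k => rho (at2 (schouten Pi V) g k) f) h = 0) ->
  exists2 V', good Pi 2 V' & schouten Pi V' = schouten Pi V.
Proof.
move=> mV gV; set W := schouten Pi V in gV *.
pose V1 := (3 : R) *: V + (-1 : R) *: leafop V.
have mL := leafop_mv mV.
have mV1 : multivector 2 V1 by apply: mv_add; exact: mv_scale.
have cW f g h : W [:: f; g; h] = W [:: g; h; f].
  by rewrite /W !schouten_mv2//; ring.
have vW f g : vector_field (at2 W f g).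
  have -> : at2 W f g = (fun h => lie (ham f) (at1 V g) h + lie (at1 V f) (ham g) h
      - ham (V [:: f; g]) h - at1 V (ham f g) h).
    by apply/funext => h; exact: dPi_at2.
  have v k := vf_at1 k mV.
  by apply: vf_sub => //; apply: vf_sub => //; apply: vf_add; exact: vf_lie.
have W1E f g h : schouten Pi V1 [:: f; g; h] = W [:: f; g; h] +
    (rho (at2 W f g) h + rho (at2 W g h) f + rho (at2 W h f) g).
  rewrite schoutenD ?schoutenZ//; [|exact: mv_scale..].
  rewrite mvDE !mvZE scaleN1r schouten_leafop_trans// -/W.
  rewrite !scaler_nat; ring.
have sW f g : at2 W f g = (fun h => - at2 W g f h).
  apply/funext => h; rewrite /at2 /W !schouten_mv2//.
  rewrite (mv2_skew h g mV) (mv2_skew h g mPi) (mv2_skew h f mV) (mv2_skew h f mPi).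
  rewrite (mv2_skew g f mV) (mv2_skew g f mPi) -!/(ham _ _).
  rewrite !(vfN _ (vf_ham _)) !(vfN _ (vf_mv2r _ mV)); ring.
have vr f g : vector_field (fun k => rho (at2 W g k) f).
  rewrite /transpart; apply: vf_sub.
    apply: (eq_vf (X := at2 W f g)) => [k|//]; by rewrite /at2 cW.
  apply: (vf_form_slot (B := fun l k => W [:: g; k; l])) (form_gammal (vf_ham f)).
    move=> l; apply: (eq_vf (X := at2 W l g)) => [k|//]; by rewrite /at2 cW.
  by move=> k; exact: vW.
(* Projecting a slot to G keeps only TF-degree 2, where 4 - L equals 2. *)
have rho1 f g h : rho (at2 (schouten Pi V1) f g) h =
    rho (at2 W f g) h + rho (at2 W f g) h.
  have -> : at2 (schouten Pi V1) f g = (fun k => at2 W f g k + (rho (at2 W f g) k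
      + rho (at2 W g k) f - rho (at2 W f k) g)).
    apply/funext => k; rewrite /at2 W1E -!/(at2 _ _ _) (sW k f) transN//.
  have v1 := vf_add (vf_trans (vW f g)) (vr f g).
  rewrite (transD h (vW f g) (vf_sub v1 (vr g f))) (transB h v1 (vr g f)).
  by rewrite (transD h (vf_trans (vW f g)) (vr f g)) trans_trans// !gV subr0 addr0.
have LV1E : schouten Pi (leafop V1) = (2 : R) *: W.
  apply: eq_mv3 => [s s3|s s3|f g h].
  - exact: (schouten_size mPi (leafop_mv mV1) (r := 3)).
  - by rewrite mvZE /W (schouten_size mPi mV (r := 3))// scaler0.
  - by rewrite schouten_leafop_trans// !rho1 W1E mvZE scaler_nat; ring.
exists (leafop ((2^-1 : R) *: V1)); first by apply: leafop_good; exact: mv_scale.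
rewrite leafopZ// schoutenZ; last exact: leafop_mv.
by rewrite LV1E scalerA mulVf ?scale1r// pnatr_eq0.
Qed.

(** * The components of [xi, xi]_gamma with two transverse slots *)

Section BracketGood.
Variables (br : mv -> mv -> mv) (xi : mv).
Hypothesis brg : gamma_bracket Pi gamma rho br.
Hypothesis gxi : good Pi 2 xi.

Let mxi : multivector 2 xi. Proof. by case: gxi. Qed.

Definition at_form (eta : (C -> C) -> C) : C -> C := fun h => eta (fun g => xi [:: g; h]).

Lemma vf_at_form eta : form1 eta -> vector_field (at_form eta).
Proof.
apply: (vf_form_slot (B := fun g h => xi [:: g; h])) => h; first exact: vf_mv2r.
exact: vf_mv2l.
Qed.

Lemma at_form_swap eta zeta : form1 eta -> form1 zeta ->
  zeta (at_form eta) = - eta (at_form zeta).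
Proof.
move=> fe fz; rewrite -(formN fe); last exact: vf_at_form.
rewrite (form_swap cof (B := fun g h => xi [:: g; h])
  (fun g => vf_mv2r g mxi) (fun h => vf_mv2l h mxi) fe fz).
apply: eq_form => g; rewrite /at_form -(formN fz); last exact: vf_mv2l.
by apply: eq_form => h; exact: mv2_skew.
Qed.

(* [bracket_terms xi xi] with 1-forms instead of differentials of functions as
   arguments. *)
Definition form_terms (a b c : (C -> C) -> C) : C :=
  rho (at_form a) (c (at_form b)) + rho (at_form b) (a (at_form c))
  + rho (at_form c) (b (at_form a))
  - (a (gbracket (at_form b) (at_form c)) + b (gbracket (at_form c) (at_form a))
     + c (gbracket (at_form a) (at_form b))).

Lemma form_terms_cyc (a b c : (C -> C) -> C) : form_terms a b c = form_terms b c a.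
Proof. rewrite /form_terms; ring. Qed.

Lemma form_terms_ext (a a' b c : (C -> C) -> C) : form1 b -> form1 c ->
  (forall X, vector_field X -> a X = a' X) -> form_terms a b c = form_terms a' b c.
Proof.
move=> fb fc aa'; rewrite /form_terms.
have -> : at_form a' = at_form a.
  by apply/funext => h; rewrite /at_form aa'//; exact: vf_mv2l.
have vb := vf_at_form fb; have vc := vf_at_form fc.
by rewrite -!aa'//; exact: vf_gbracket.
Qed.

(** The derivatives of r cancel because xi(a, c) = - xi(c, a), which is [at_form_swap]. *)
Lemma form_terms_lin r (a a' b c : (C -> C) -> C) :
  form1 a -> form1 a' -> form1 b -> form1 c ->
  form_terms (fun X => r * a X + a' X) b c = r * form_terms a b c + form_terms a' b c.
Proof.
move=> fa fa' fb fc.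
have va := vf_at_form fa; have va' := vf_at_form fa'.
have vb := vf_at_form fb; have vc := vf_at_form fc.
have vra := vf_scale r va.
rewrite /form_terms.
have -> : at_form (fun X => r * a X + a' X) = (fun h => r * at_form a h + at_form a' h).
  by [].
rewrite transD// transZ// (formD fb vra va') (formZ fb r va).
have -> : gbracket (at_form c) (fun h => r * at_form a h + at_form a' h) =
    (fun h => r * gbracket (at_form c) (at_form a) h + rho (at_form c) r * at_form a h
              + gbracket (at_form c) (at_form a') h).
  by apply/funext => h; rewrite gbracketDr// gbracketZr.
have -> : gbracket (fun h => r * at_form a h + at_form a' h) (at_form b) =
    (fun h => r * gbracket (at_form a) (at_form b) h + (- rho (at_form b) r) * at_form a h
              + gbracket (at_form a') (at_form b) h).
  by apply/funext => h; rewrite gbracketDl// gbracketZl// mulNr.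
have vca := vf_gbracket vc va; have vab := vf_gbracket va vb.
have vca' := vf_gbracket vc va'; have vab' := vf_gbracket va' vb.
rewrite (formD fb (vf_add (vf_scale r vca) (vf_scale _ va)) vca').
rewrite (formD fb (vf_scale r vca) (vf_scale _ va)) (formZ fb _ vca) (formZ fb _ va).
rewrite (formD fc (vf_add (vf_scale r vab) (vf_scale _ va)) vab').
rewrite (formD fc (vf_scale r vab) (vf_scale _ va)) (formZ fc _ vab) (formZ fc _ va).
rewrite (vfD _ _ (vf_trans vb)) (vfD _ _ (vf_trans vc)).
rewrite (vfM _ _ (vf_trans vb)) (vfM _ _ (vf_trans vc)).
rewrite (at_form_swap fa fc); ring.
Qed.

(** As xi is good, xi(b, -) and xi(c, -) are tangent to TF. The bracket of such a field with any X
    is again tangent to TF, hence killed by b and c, and the bracket of the two fields is zero. *)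
Lemma form_terms_annihilator (a b c : (C -> C) -> C) :
  form1 a -> annihilator Pi b -> annihilator Pi c ->
  form_terms a b c = 0.
Proof.
move=> fa ab ac; have [fb _] := ab; have [fc _] := ac.
have va := vf_at_form fa; have vb := vf_at_form fb; have vc := vf_at_form fc.
(* Goodness is tested against e and the annihilator X -> (rho X) h. *)
have tangent e : annihilator Pi e -> forall h, rho (at_form e) h = 0.
  move=> ae h; case: gxi => _ /(_ _ _ (annihilator_trans h) ae).
  by move/(congr1 (fun W : mv => W [::])).
have leaf e : annihilator Pi e -> at_form e = F (at_form e).
  move=> ae; apply/funext => h; apply/eqP; rewrite -subr_eq0; apply/eqP.
  exact: tangent.
have leafr X e : vector_field X -> annihilator Pi e ->
    gbracket (at_form e) X = F (lie (at_form e) (rho X)).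
  move=> vX ae; apply/funext => h; rewrite /gbracket.
  have -> : rho (at_form e) = (fun=> 0) by apply/funext => k; exact: tangent.
  have l0 (Y : C -> C) : vector_field Y -> lie (fun=> 0) Y = (fun=> 0).
    by move=> vY; apply/funext => k; rewrite /lie (vf0 vY) subr0.
  rewrite !l0//; last exact: vf_trans.
  by rewrite /leafpart (form0 (form_gammal (vf_ham h))) !add0r.
have lv X e : vector_field X -> annihilator Pi e ->
    vector_field (lie (at_form e) (rho X)).
  by move=> vX [fe _]; apply: vf_lie; [exact: vf_at_form|exact: vf_trans].
rewrite /form_terms !(tangent _ ab) !(tangent _ ac).
have cb0 : c (at_form b) = 0 by rewrite (leaf b ab) (annihilator_leaf ac vb).
rewrite cb0 (vf0 (vf_trans va)).
rewrite (leafr _ c va ac) (annihilator_leaf ab (lv _ _ va ac)).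
have -> : gbracket (at_form a) (at_form b) =
    (fun h => - gbracket (at_form b) (at_form a) h).
  by apply/funext => h; exact: gbracket_skew.
rewrite (formN fc (vf_gbracket vb va)) (leafr _ b va ab).
rewrite (annihilator_leaf ac (lv _ _ va ab)).
rewrite (leafr _ b vc ab).
have -> : rho (at_form c) = (fun=> 0) by apply/funext => k; exact: tangent.
have -> : lie (at_form b) (fun=> 0) = (fun=> 0).
  by apply/funext => k; rewrite /lie (vf0 vb) subr0.
have -> : F (fun=> 0) = (fun=> 0).
  by apply/funext => h; exact: (form0 (form_gammal (vf_ham h))).
by rewrite (form0 fa); ring.
Qed.

Let W := br xi xi.

Let mW : multivector 3 W.
Proof. exact: (@gamma_bracket_deg _ _ _ _ _ _ _ brg 2 2 3 _ _ erefl mxi mxi). Qed.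

(** [br_mv2] covers differentials; [form1_ind] extends it to 1-forms, one slot here and a second one
    in [br_at2_form_form]. *)
Lemma br_at2_form (a : (C -> C) -> C) g k : form1 a -> a (at2 W g k) =
  - (form_terms a (fun X => X g) (fun X => X k)
     + form_terms a (fun X => X g) (fun X => X k)).
Proof.
move=> fa; apply/eqP; rewrite -subr_eq0 opprK; apply/eqP; move: a fa.
apply: (form1_ind cof) => [e e' ee'|r e e' fe fe'|f].
- by rewrite (form_terms_ext _ _ ee')// ee'//; exact: vf_mv3.
- rewrite form_terms_lin//; ring.
- by rewrite /at2 /W (br_mv2 brg)// form_terms_cyc; exact: addNr.
Qed.

Lemma br_at2_form_form (a b : (C -> C) -> C) g : form1 a -> form1 b ->
  b (fun k => a (at2 W g k)) =
  - (form_terms b a (fun X => X g) + form_terms b a (fun X => X g)).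
Proof.
move=> fa fb; apply/eqP; rewrite -subr_eq0 opprK; apply/eqP; move: b fb.
have va : vector_field (fun k => a (at2 W g k)).
  apply: (vf_form_slot (B := fun l k => W [:: g; k; l])) => // k.
    exact: vf_mv3m.
  exact: vf_mv3.
apply: (form1_ind cof) => [e e' ee'|r e e' fe fe'|f].
- by rewrite (form_terms_ext _ _ ee')// ee'.
- rewrite form_terms_lin//; ring.
- by rewrite br_at2_form// (form_terms_cyc _ a) addNr.
Qed.

Lemma br_trans_trans f g h : rho (fun k => rho (at2 W g k) f) h = 0.
Proof.
have [ff fh] := (annihilator_trans f, annihilator_trans h).
rewrite (br_at2_form_form g ff.1 fh.1) -form_terms_cyc.
by rewrite form_terms_annihilator ?addr0 ?oppr0//.
Qed.

End BracketGood.

End Core.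

(** * Equivalence of the two exactness conditions *)

Theorem corollary6p3 (R : realType) (n : nat) (M : manifold R n)
  (Pi : seq (smoothFun M) -> smoothFun M)
  (G : M -> set (smoothFun M -> R))
  (prG : (smoothFun M -> smoothFun M) -> smoothFun M -> smoothFun M)
  (omega gamma : (smoothFun M -> smoothFun M) ->
                 (smoothFun M -> smoothFun M) -> smoothFun M)
  (br : (seq (smoothFun M) -> smoothFun M) ->
        (seq (smoothFun M) -> smoothFun M) ->
        seq (smoothFun M) -> smoothFun M)
  (Pi_poisson : poisson Pi)
  (Pi_regular : regular Pi)
  (G_subbundle : subbundle G)
  (G_complement : complement (TF Pi) G)
  (prG_projection : projection (TF Pi) G prG)
  (omega_symplectic : leafwise_symplectic Pi omega)
  (gamma_extension : extension_by_zero Pi G omega gamma)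
  (gamma_closed : closed_form2 gamma)
  (br_gamma : gamma_bracket Pi gamma prG br)
  (xi : seq (smoothFun M) -> smoothFun M)
  (xi_deformation : infinitesimal_deformation Pi xi) :
  exact_in Pi (good Pi) 2 (br xi xi) <->
  exact_in Pi multivector 2 (schouten xi xi).
Proof.
have [mPi PiPi] := Pi_poisson; have [gxi cxi] := xi_deformation.
have [mxi _] := gxi; have [fgamma gamma_TF gamma_G] := gamma_extension.
have [_ _ sharp_omega] := omega_symplectic.
have vH f : vector_field (ham Pi f) by exact: vf_mv2r.
have fg X : vector_field X -> form1 (gamma X) by case: fgamma => + _; exact.
have sharpE eta f : form1 eta -> sharp Pi eta f = - eta (ham Pi f).
  move=> fe; rewrite /sharp /Defs.contract -(formN fe (vH f)).
  by apply: eq_form => g; exact: mv2_skew.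
have cof : @coframed R n M.
  have [_ G_dim G_section] := G_subbundle.
  apply: (coframed_complement Pi_regular G_dim _ _ G_complement) => [x v [eta fe ->]|x v].
    exists (sharp Pi eta) => //.
    apply: (vf_form_slot (B := fun g f => Pi [:: g; f])) fe => h; first exact: vf_mv2r.
    exact: vf_mv2l.
  by move=> /G_section[X [vX _] <-]; exists X.
have jac f g h : ham Pi f (ham Pi g h) + ham Pi g (ham Pi h f) + ham Pi h (ham Pi f g) = 0.
  by apply: double_eq0; rewrite -(schouten_mv2 f g h mPi mPi) PiPi.
(* On TF the form gamma X restricts to omega X, so the relation Pi = - omega^-1 gives Pi^sharp
   (gamma X) = - X. *)
have leaf_TF X f : section (TF Pi) X -> leafpart Pi gamma X f = X f.
  move=> TX; have [vX _] := TX.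
  have := sharp_omega X (gamma X) TX (fg X vX) (fun Y => gamma_TF X Y TX).
  by move=> /(congr1 (fun Y => Y f)); rewrite sharpE; [move/oppr_inj|exact: fg].
have ham_TF f : section (TF Pi) (ham Pi f).
  by split=> // x; exists (fun X => X f); first exact: form1_d.
have gamma_ham f g : gamma (ham Pi f) (ham Pi g) = ham Pi f g by exact: leaf_TF.
(* gamma kills [prG X], and X - prG X lies in TF, so that it equals its leafwise part. *)
have prE X : vector_field X -> prG X = transpart Pi gamma X.
  move=> vX; have [GX TX] := prG_projection X vX; have [vG _] := GX.
  apply/funext => f; rewrite /transpart.
  have := leaf_TF _ f TX; rewrite /leafpart (formB (form_gammal fgamma (vH f)) vX vG).
  by rewrite (gamma_G _ GX)// subr0 => ->; rewrite /= opprB addrC subrK.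
have gamma_trans X Y : vector_field X -> vector_field Y ->
    gamma (transpart Pi gamma X) Y = 0.
  move=> vX vY; rewrite -prE//; apply: gamma_G => //.
  by have [] := prG_projection X vX.
have brg : gamma_bracket Pi gamma (transpart Pi gamma) br.
  case: br_gamma => b1 b2 b3 b4 b5 b6 b7; split=> // [X f vX|X Y vX vY].
    by rewrite b5// prE.
  by rewrite b6// !prE.
have mk := gamma_square_mv fgamma mxi.
have brE := br_cocycle cof mPi jac fgamma gamma_closed gamma_ham gamma_trans brg mxi cxi.
have dD := schoutenD mPi; have mkk := mv_add mk mk.
split=> [[V [mV _] dV]|[V mV dV]].
(* The primitive V - 2 kappa need not be good, which the right-hand side allows. *)
- exists (V + (-1 : R) *: (gamma_square gamma xi + gamma_square gamma xi)).
    by apply: mv_add => //; exact: mv_scale.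
  rewrite /d_Pi dD// ?schoutenZ//; last exact: mv_scale.
  by rewrite -/(d_Pi Pi V) dV brE dD// scaleN1r addrK.
(* V + 2 kappa is a primitive of [xi, xi]_gamma, in general not a good one; [exact_good] replaces it
   by a good one. *)
- have brV : br xi xi = schouten Pi (V + (gamma_square gamma xi + gamma_square gamma xi)).
    by rewrite brE !dD// -/(d_Pi Pi V) dV.
  rewrite brV; apply: (exact_good cof mPi jac fgamma gamma_closed gamma_ham gamma_trans).
    exact: mv_add.
  by move=> f g h; rewrite -brV; apply: br_trans_trans.
Qed.
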